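(* For every $n\in\mathbb{Z}_{>0}$, let $\boldsymbol{\sigma}^n$ be a uniform random $321$-avoiding permutation of size $n$. Then, for all $\pi\in\mathrm{Av}(321)$, we have the following convergence in probability as $n\to\infty$: $$\widetilde{\mathrm{c\text{-}occ}}(\pi,\boldsymbol{\sigma}^n)\xrightarrow{P}\begin{cases}\frac{|\pi|+1}{2^{|\pi|}}&\text{if }\pi=12\dots|\pi|,\\ \frac{1}{2^{|\pi|}}&\text{if }\mathrm{c\text{-}occ}(21,\pi^{-1})=1,\\ 0&\text{otherwise.}\end{cases}$$
   Context: $\mathcal{S}^n$ is the set of permutations $\sigma=\sigma_1\cdots\sigma_n$ of $[n]=\{1,\dots,n\}$, with size $|\sigma|=n$. For $I\subseteq[n]$, $\mathrm{pat}_I(\sigma)$ is the permutation of size $|I|$ in the same relative order as $(\sigma_i)_{i\in I}$. The permutation $\sigma$ avoids $\rho$ if there is no subset $I\subseteq[n]$ (not necessarily an interval) with $\mathrm{pat}_I(\sigma)=\rho$; $\mathrm{Av}^n(\rho)$ is the set of $\rho$-avoiding permutations of size $n$ and $\mathrm{Av}(\rho)=\bigcup_{n\ge1}\mathrm{Av}^n(\rho)$. $\mathrm{c\text{-}occ}(\pi,\sigma)$ is the number of integer intervals $I\subseteq[n]$ with $|I|=|\pi|$ and $\mathrm{pat}_I(\sigma)=\pi$, and $\widetilde{\mathrm{c\text{-}occ}}(\pi,\sigma)=\mathrm{c\text{-}occ}(\pi,\sigma)/n$ where $n=|\sigma|$. In particular $\mathrm{c\text{-}occ}(21,\pi^{-1})$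 is the number of descents of the inverse permutation $\pi^{-1}$. *)

(* Defs.v *)
From HB Require Import structures.
From mathcomp Require Import all_boot all_order all_algebra all_fingroup.
From mathcomp Require Import all_classical all_reals all_analysis.
Set Implicit Arguments.
Unset Strict Implicit.
Unset Printing Implicit Defensive.
Import Order.TTheory GRing.Theory Num.Theory.
Import numFieldNormedType.Exports.
Local Open Scope ring_scope.

(* A permutation s : 'S_n is read in one-line notation as the word
   s 0, ..., s (n-1); positions and values are numbered from 0. *)

Section Pattern.
Variables (n : nat) (s : 'S_n) (I : {set 'I_n}).

Definition pat_rank (x : 'I_n) : nat := #|[set j in I | (s j < s x)%N]|.

Lemma pat_rank_mono :
  {in I &, forall x y, (pat_rank x < pat_rank y)%N = (s x < s y)%N}.
Proof.
move=> x y xI yI; case: (ltnP (s x) (s y)) => sxy.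
  apply: proper_card; apply/properP; split.
    by apply/fintype.subsetP => j; rewrite !inE => /andP[-> /ltn_trans]; apply.
  by exists x; rewrite !inE xI ?sxy ?ltnn.
apply/negbTE; rewrite -leqNgt; apply: subset_leq_card.
apply/fintype.subsetP => j; rewrite !inE => /andP[-> syj].
exact: leq_trans sxy.
Qed.

Lemma pat_rank_lt (a : 'I_#|I|) : (pat_rank (enum_val a) < #|I|)%N.
Proof.
apply: proper_card; apply/properP; split.
  by apply/fintype.subsetP => j; rewrite inE => /andP[].
by exists (enum_val a); rewrite ?inE ?ltnn ?andbF// enum_valP.
Qed.

Lemma pat_inj : injective (fun a : 'I_#|I| => Ordinal (pat_rank_lt a)).
Proof.
move=> a b [eab]; apply: enum_val_inj; apply: (@perm_inj _ s); apply: val_inj.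
have [aI bI] := (enum_valP a, enum_valP b).
have := pat_rank_mono aI bI; have := pat_rank_mono bI aI.
by rewrite eab ltnn; case: (ltngtP (s (enum_val a)) (s (enum_val b))).
Qed.

(* enum_val lists the positions in I in increasing order. *)
Definition pat : 'S_#|I| := perm pat_inj.

Lemma patE (a b : 'I_#|I|) :
  (pat a < pat b)%N = (s (enum_val a) < s (enum_val b))%N.
Proof. by rewrite !permE /= pat_rank_mono ?enum_valP. Qed.

End Pattern.

(* Equality of permutations of possibly different sizes. *)
Definition same_perm (m k : nat) (s : 'S_m) (t : 'S_k) : bool :=
  Tagged (fun i => {perm 'I_i}) s == Tagged (fun i => {perm 'I_i}) t.

Definition avoids (n k : nat) (rho : 'S_k) (s : 'S_n) : bool :=
  ~~ [exists I : {set 'I_n}, same_perm (pat s I) rho].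

Definition Av (k : nat) (rho : 'S_k) (n : nat) : {set 'S_n} :=
  [set s | avoids rho s].

(* Only nonempty intervals, which suffices as patterns have positive size. *)
Definition ord_interval (n : nat) (I : {set 'I_n}) : bool :=
  [exists a : 'I_n, exists b : 'I_n, I == [set i : 'I_n | (a <= i <= b)%N]].

Definition cocc (k n : nat) (pi : 'S_k) (s : 'S_n) : nat :=
  #|[set I : {set 'I_n} |
      [&& ord_interval I, #|I| == k & same_perm (pat s I) pi]]|.

Definition cocc_freq (R : realType) (k n : nat) (pi : 'S_k) (s : 'S_n) : R :=
  (cocc pi s)%:R / n%:R.

(* The decreasing permutation k ... 2 1. *)
Definition decr (k : nat) : 'S_k := perm (@rev_ord_inj k).

Local Open Scope classical_set_scope.

Definition uniform_on (R : realType) (d : measure_display)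
    (Omega : measurableType d) (P : probability Omega R)
    (S : finType) (A : {set S}) (X : Omega -> S) : Prop :=
  forall s : S, measurable (X @^-1` [set s]) /\
    P (X @^-1` [set s]) = (if s \in A then #|A|%:R^-1 else 0)%:E.

(* The variables may live on different probability spaces; the limit is a
   constant. *)
Definition cvg_in_probability (R : realType) (d : nat -> measure_display)
    (Omega : forall n, measurableType (d n))
    (P : forall n, probability (Omega n) R)
    (X : forall n, Omega n -> R) (c : R) : Prop :=
  forall eps : R, 0 < eps ->
    P n [set w | eps < `|X n w - c|] @[n --> \oo] --> 0%E.

Definition cocc_limit (R : realType) (k : nat) (pi : 'S_k) : R :=
  if pi == 1%g then (k + 1)%:R / 2 ^+ k
  else if cocc (decr 2) (pi^-1)%g == 1%N then 1 / 2 ^+ k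
  else 0.

(* Main.v *)
(* A 321-avoiding permutation is increasing on its weak excedances and on the other
   positions, so it is determined by the word recording, for each index [i], whether the
   point in column [i] and the point in row [i] are weak excedances.  Uniform pairs of
   binary words of length [n] are exponentially concentrated, and the words of permutations
   form a polynomial proportion (a Catalan number out of [4^n]) of all pairs; so every event
   that is rare for coin flips stays rare for a uniform 321-avoiding permutation.

   For coin flips, the number of occurrences of a fixed factor of length [k] in the column
   word is close to [n / 2^k], and a nonnegative walk, here the number of points crossing the
   diagonal above [i], is rarely bounded.  Where more than [k] points cross, every weak
   excedance of a window of size [k] lies above every other point of it.  The pattern in the
   window is then read off the factor, and [pi] is obtained from [k + 1], [1] or [0] factors
   according to the number of descents of its inverse. *)
Require Import Defs.
From HB Require Import structures.
From mathcomp Require Import all_boot all_order all_algebra all_fingroup.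
From mathcomp Require Import all_classical all_reals all_analysis.
From mathcomp Require Import zify ring lra.
Set Implicit Arguments.
Unset Strict Implicit.
Unset Printing Implicit Defensive.
Import Order.TTheory GRing.Theory Num.Theory.
Import numFieldNormedType.Exports.
Local Open Scope ring_scope.

(** * Rare events for uniform words *)

Lemma big_tuple_cons (R : Type) (idx : R) (op : Monoid.com_law idx)
    (T : finType) n (F : seq T -> R) :
  \big[op/idx]_(t : n.+1.-tuple T) F t =
  \big[op/idx]_(a : T) \big[op/idx]_(t : n.-tuple T) F (a :: t).
Proof.
rewrite pair_big /=.
rewrite (reindex (fun x : T * n.-tuple T => cons_tuple x.1 x.2)) //=.
exists (fun t => (thead t, [tuple of behead t])) => [[a t] _|t _] /=.
  by congr pair; apply: val_inj.
by rewrite [RHS](tuple_eta t); apply: val_inj.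
Qed.

(** The hypothesis makes [F] a supermartingale for words grown to the left by uniform letters; its
    mean decreases, here before division by the number of words. *)
Lemma sum_tuple_supermartingale (R : realFieldType) (T : finType)
    (F : seq T -> R) n :
  (forall s, \sum_a F (a :: s) <= #|T|%:R * F s) ->
  \sum_(t : n.-tuple T) F t <= #|T|%:R ^+ n * F [::].
Proof.
move=> HF; elim: n => [|n IHn].
  rewrite expr0 mul1r (eq_bigr (fun=> F [::])); last by move=> t _; rewrite tuple0.
  by rewrite sumr_const card_tuple expn0.
rewrite big_tuple_cons exchange_big /= exprS -mulrA.
apply: le_trans (ler_wpM2l (ler0n _ _) IHn).
by rewrite mulr_sumr; apply: ler_sum => t _; exact: HF.
Qed.

(** Bernoulli's inequality bounds the linear term by a multiple of [tau ^+ L], where [tau] is a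
    fourth root of [rho]; its cube then stays below a multiple of [tau ^+ (4 * L)]. *)
Lemma cubic_le_expr (R : realType) (rho : R) (m : nat) : 1 < rho ->
  exists2 C : R, 0 <= C & forall L, ((m * L).+1 ^ 3)%:R <= C * rho ^+ L.
Proof.
move=> rho1; pose tau := Num.sqrt (Num.sqrt rho).
have tau1 : 1 < tau.
  have r1 : Num.sqrt 1 < Num.sqrt rho by rewrite ltr_sqrt; lra.
  by rewrite sqrtr1 in r1; rewrite -sqrtr1 ltr_sqrt; lra.
have tau4 : tau ^+ 4 = rho.
  rewrite (_ : 4 = 2 * 2)%N // exprM sqr_sqrtr ?sqrtr_ge0// sqr_sqrtr//; lra.
pose D := 1 + m%:R / (tau - 1) : R.
have D1 : 1 <= D by rewrite lerDl divr_ge0// subr_ge0 ltW.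
exists (D ^+ 3); first by rewrite exprn_ge0; lra.
move=> L.
have H : (m * L).+1%:R <= D * tau ^+ L.
  have bern j : 1 + j%:R * (tau - 1) <= tau ^+ j.
    elim: j => [|j IH]; first by rewrite mul0r addr0 expr0.
    rewrite exprS; have := ler_wpM2l (_ : 0 <= tau) IH.
    move=> /(_ ltac:(lra)); apply: le_trans.
    have j0 : 0 <= j%:R * (tau - 1) by rewrite mulr_ge0// subr_ge0 ltW.
    rewrite -natr1; nra.
  have E : m%:R * L%:R = m%:R / (tau - 1) * (L%:R * (tau - 1)).
    by field; lra.
  rewrite -natr1 natrM E /D.
  have c0 : 0 <= m%:R / (tau - 1) by rewrite divr_ge0// subr_ge0 ltW.
  have := bern L; have : 0 <= L%:R * (tau - 1) by rewrite mulr_ge0// subr_ge0 ltW.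
  move: (m%:R / _) (L%:R * _) (tau ^+ L) c0 => c x y c0 x0 xy; nra.
rewrite natrX; apply: (@le_trans _ _ ((D * tau ^+ L) ^+ 3)).
  by rewrite lerXn2r// ?nnegrE// mulr_ge0// ?exprn_ge0//; lra.
rewrite exprMn ler_wpM2l ?exprn_ge0//; first by lra.
rewrite -tau4 -!exprM mulnC ler_weXn2l//; first exact: ltW.
by rewrite leq_mul2r orbT.
Qed.

Definition letter : Type := (bool * bool)%type.
HB.instance Definition _ := Finite.on letter.

(* The cube leaves a factor [1/n] after division by the proportion [1/((n + 1)(2n + 1))]
   of words that come from permutations. *)
Definition rare (R : realType) (B : pred (seq letter)) : Prop :=
  exists C : R, forall n,
    (n.+1 ^ 3)%:R * #|[set t : n.-tuple letter | B t]|%:R <= C * 4 ^+ n.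

Lemma card_letter : #|{: letter}| = 4%N.
Proof. by rewrite card_prod card_bool. Qed.

Lemma big_letter (R : Type) (idx : R) (op : Monoid.com_law idx) (F : letter -> R) :
  \big[op/idx]_a F a =
  op (op (op (F (true, true)) (F (true, false))) (F (false, true))) (F (false, false)).
Proof.
rewrite (eq_bigr (fun a => F (a.1, a.2))); last by case.
by rewrite -(pair_bigA _ (fun a b => F (a, b))) !big_bool /= !Monoid.mulmA.
Qed.

Lemma rareU (R : realType) (B1 B2 : pred (seq letter)) :
  rare R B1 -> rare R B2 -> rare R (predU B1 B2).
Proof.
move=> [C1 H1] [C2 H2]; exists (C1 + C2) => n.
rewrite mulrDl; apply: le_trans (lerD (H1 n) (H2 n)).
rewrite -mulrDr ler_wpM2l// -natrD ler_nat.
apply: leq_trans (leq_card_setU _ _).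
by apply: subset_leq_card; apply/fintype.subsetP => t; rewrite !inE.
Qed.

Lemma rare_has (R : realType) (I : eqType) (r : seq I) (B : I -> pred (seq letter)) :
  (forall i, rare R (B i)) -> rare R (fun s => has (fun i => B i s) r).
Proof.
move=> HB; elim: r => [|i r IH].
  by exists 0 => n; rewrite (_ : [set _ | _] = finset.set0) ?cards0 ?mulr0 ?mul0r//;
    apply/setP => t; rewrite !inE.
by have [C H] := rareU (HB i) IH; exists C.
Qed.

(** Markov's inequality: [C * F] dominates the cube on [B], while the sum of [F] over all words is
    at most [4 ^ n] times its value at the empty word. *)
Lemma rare_supermartingale (R : realType) (B : pred (seq letter))
    (F : seq letter -> R) (C : R) :
  (forall s, \sum_a F (a :: s) <= 4 * F s) -> (forall s, 0 <= F s) -> 0 <= C ->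
  (forall s, B s -> ((size s).+1 ^ 3)%:R <= C * F s) -> rare R B.
Proof.
move=> HF F0 C0 HB; exists (C * F [::]) => n.
have := @sum_tuple_supermartingale R letter F n.
rewrite card_letter => /(_ HF) H.
apply: (@le_trans _ _ (C * \sum_(t : n.-tuple letter) F t)); last first.
  by rewrite -mulrA ler_wpM2l// mulrC.
rewrite mulr_natr -sumr_const mulr_sumr.
apply: (@le_trans _ _ (\sum_(t in [set t : n.-tuple letter | B t]) C * F t)).
  by apply: ler_sum => t; rewrite inE => /HB; rewrite size_tuple.
rewrite [leRHS](bigID (fun t : n.-tuple letter => B t)) /=.
rewrite (eq_bigl (fun t : n.-tuple letter => B t)); last by move=> t; rewrite inE.
by rewrite lerDl; apply: sumr_ge0 => t _; rewrite mulr_ge0.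
Qed.

(** * Low visits of a nonnegative walk *)

Definition bz (b : bool) : int := (b : nat)%:Z.

(* Words are read from the right; in the word of a permutation, [height (drop i s)] is the
   number of points crossing the diagonal above [i]. *)
Fixpoint height (s : seq letter) : int :=
  if s is a :: s' then height s' + bz a.2 - bz a.1 else 0.

Fixpoint nonneg (s : seq letter) : bool :=
  (0 <= height s) && (if s is _ :: s' then nonneg s' else true).

Fixpoint low (K : nat) (s : seq letter) : nat :=
  if s is _ :: s' then ((height s' <= K%:Z)%R + low K s')%N else 0%N.

(* [1 - 2^-(h+1)] vanishes at height [-1] and is superharmonic for the lazy walk,
   with a multiplicative gain at bounded heights. *)
Lemma rare_low (R : realType) (K m : nat) :
  rare R (fun s => nonneg s && (size s <= m * low K s)%N).
Proof.
pose g (h : int) : R := 1 - 2 ^ (- h - 1).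
(* Averaged over the four letters, a step from height [h] lowers [g] by [2 ^ (- h - 1) / 8], which
   is at least [beta] if [h <= K]. As [g <= 1], this pays for a factor [(1 - beta)^-1]. *)
pose beta : R := 2 ^ (- K%:Z - 1) / 8.
have two0 : 2 != 0 :> R by rewrite pnatr_eq0.
have beta0 : 0 < beta by rewrite divr_gt0// exprz_gt0.
have beta1 : beta < 1.
  rewrite /beta ltr_pdivrMr// mul1r (@le_lt_trans _ _ 1)//; last by lra.
  by rewrite -[leRHS](expr0z (2:R)) ler_weXz2l//; try lra; lia.
have [C C0 HC] := @cubic_le_expr R (1 - beta)^-1 m ltac:(by rewrite invf_gt1; lra).
pose rho := (1 - beta)^-1.
have rho1 : 1 < rho by rewrite invf_gt1; lra.
(* The value 0 once the walk turns negative is consistent with [g (-1) = 0], since a step changes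
   the height by at most 1. *)
pose F s := if nonneg s then g (height s) * rho ^+ low K s else 0.
have g_ge h : 0 <= h -> 1 / 2 <= g h.
  move=> h0; rewrite /g; suff : 2 ^ (- h - 1) <= (1/2 : R) by lra.
  rewrite div1r -[leRHS]exprN1 ler_weXz2l//; try lra; lia.
have g_ge0 h : -1 <= h -> 0 <= g h.
  move=> h0; rewrite /g subr_ge0 -[leRHS](expr0z (2:R)) ler_weXz2l//; try lra; lia.
have H0 s : nonneg s -> 0 <= height s by case: s => [|a s] //= /andP[].
apply: (@rare_supermartingale R _ F (2 * C)) => [s|s||s].
- pose r : R := rho ^+ ((height s <= K%:Z)%R + low K s).
  have r0 : 0 < r by rewrite exprn_gt0; lra.
  case: (boolP (nonneg s)) => ns; last first.
    by rewrite big1 /F ?(negbTE ns) ?mulr0// => a _; rewrite /= (negbTE ns) andbF.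
  have h0 := H0 _ ns.
  have Fa a : F (a :: s) <= g (height s + bz a.2 - bz a.1) * r.
    rewrite /F /= ns andbT; case: ifP => // _.
    by rewrite mulr_ge0 ?(ltW r0)// g_ge0//; case: a => -[] [] /=; rewrite /bz /=; lia.
  have : \sum_a F (a :: s) <= \sum_(a : letter) g (height s + bz a.2 - bz a.1) * r.
    by apply: ler_sum => a _; exact: Fa.
  move=> /le_trans; apply; rewrite big_letter /= /bz /F ns.
  set h := height s in h0 *.
  rewrite -!mulrDl /r exprD mulrA mulrA ler_wpM2r//; first by rewrite exprn_ge0//; lra.
  have -> : h + 1%N%:Z - 1%N%:Z = h by lia.
  have -> : h + 0%N%:Z - 0%N%:Z = h by lia.
  have E1 : g (h + 1%N%:Z - 0%N%:Z) = 1 - 2 ^ (- h - 1) / 2.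
    by rewrite /g -exprN1 -expfzDr//; congr (1 - 2 ^ _); lia.
  have E2 : g (h + 0%N%:Z - 1%N%:Z) = 1 - 2 ^ (- h - 1) * 2.
    by rewrite /g -[X in _ * X]expr1z -expfzDr//; congr (1 - 2 ^ _); lia.
  rewrite E1 E2; have x0 : 0 < (2:R) ^ (- h - 1) by rewrite exprz_gt0.
  case: (leP h K%:Z) => hK /=; last by rewrite /g expr0 mulr1; lra.
  rewrite expr1 /rho ler_pdivrMr; last by lra.
  have bx : beta <= 2 ^ (- h - 1) / 8.
    by rewrite /beta ler_pM2r; [rewrite ler_weXz2l//; try lra; lia|lra].
  have gx : 1/2 <= g h by exact: g_ge.
  rewrite /g in gx *; move: (2 ^ (- h - 1)) x0 bx gx => x x0 bx gx; nra.
- rewrite /F; case: ifP => // /H0 h0; rewrite mulr_ge0 ?exprn_ge0//; last by lra.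
  by apply: g_ge0; lia.
- by rewrite mulr_ge0.
- move=> /andP[ns sz]; rewrite /F ns.
  have := HC (low K s); rewrite -/rho => H.
  apply: (@le_trans _ _ (C * rho ^+ low K s)).
    by apply: le_trans H; rewrite ler_nat leq_exp2r// ltnS.
  have := g_ge _ (H0 _ ns); have : 0 <= C * rho ^+ low K s.
    by rewrite mulr_ge0// exprn_ge0//; lra.
  rewrite (_ : 2 * C * _ = 2 * g (height s) * (C * rho ^+ low K s)); last by ring.
  move: (C * _) (g _) => x y; nra.
Qed.

(** * Factor counts of the column word *)

Definition at_head (w : seq bool) (s : seq letter) : bool := prefix w (unzip1 s).

Fixpoint cnt (w : seq bool) (s : seq letter) : nat :=
  (at_head w s + if s is _ :: s' then cnt w s' else 0)%N.

(* A martingale when the letters are revealed from right to left: the suffix already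
   seen decides whether the next letter counts. *)
Fixpoint drift (b : bool) (w : seq bool) (s : seq letter) : int :=
  if s is a :: s' then
    drift b w s' + bz (at_head w s') * (if a.1 == b then 1 else -1) else 0.

Lemma driftN b w s : drift (~~ b) w s = - drift b w s.
Proof.
elim: s => //= a s ->; rewrite opprD; congr (_ + _).
by case: a.1; case: b => /=; rewrite ?mulr1 ?mulrN1 ?opprK.
Qed.

Lemma cnt_nil s : cnt [::] s = (size s).+1.
Proof. by elim: s => //= a s ->. Qed.

(** An occurrence of [w] that is not at the head follows a letter, equal to [b] or not: twice the
    indicator of [b] is 1 plus the sign recorded by [drift]. *)
Lemma cnt_cons b w s :
  (2 * cnt (b :: w) s)%:Z = (cnt w s)%:Z - bz (at_head w s) + drift b w s.
Proof.
elim: s => [|a s IH] /=.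
  by rewrite /at_head /=; case: w => [|? ?] //=.
rewrite mulnDr PoszD IH /at_head /= /bz.
have E : (b == a.1) = (a.1 == b) by rewrite eq_sym.
rewrite E; case: (a.1 == b); case: (prefix w (unzip1 s)) => /=; lia.
Qed.

(** By [cnt_cons], prefixing a letter halves the count, up to a drift of at most [size s / m] and a
    boundary term of at most 1. Scaled by [2 ^ size w], this error equals the bound already reached,
    which therefore doubles. *)
Lemma cnt_deviation (m k : nat) (s : seq letter) :
  (forall b w, (size w < k)%N -> m%:Z * drift b w s <= (size s)%:Z) ->
  forall w, (size w <= k)%N ->
  m%:Z * `|(2 ^ size w * cnt w s)%:Z - (size s).+1%:Z|
    <= (2 ^ size w)%:Z * ((size s)%:Z + m%:Z).
Proof.
move=> H; elim=> [|b w IH] /= sz.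
  by rewrite cnt_nil mul1n subrr normr0 mulr0 expn0 mul1r.
(* The drift for the opposite letter is the negated drift, so the two one-sided bounds control its
   absolute value. *)
have := IH (ltnW sz); have := H b w sz; have := H (~~ b) w sz; rewrite driftN.
have := cnt_cons b w s; rewrite expnS.
have b1 : 0 <= bz (at_head w s) <= 1 by case: at_head.
set q := (2 ^ size w)%N; have q0 : (0 < q)%N by rewrite expn_gt0.
move: (bz _) b1 (cnt _ _) (cnt w s) (drift b w s) (size s) => e /andP[e0 e1] c c' d n.
move=> E d1 d2 IHw.
have E2 : (2 * q * c)%:Z - n.+1%:Z = ((q * c')%:Z - n.+1%:Z) + q%:Z * (d - e).
  have -> : (2 * q * c)%:Z = q%:Z * (2 * c)%:Z by lia.
  by rewrite E; lia.
rewrite E2.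
have T := ler_normD ((q * c')%:Z - n.+1%:Z) (q%:Z * (d - e)).
have N : m%:Z * `|q%:Z * (d - e)| <= q%:Z * (n%:Z + m%:Z).
  rewrite normrM (ger0_norm (_ : 0 <= q%:Z))// mulrCA ler_wpM2l//.
  have [] : `|d - e| = d - e \/ `|d - e| = - (d - e) by lia.
    move=> ->; nia.
  move=> ->; nia.
have m0 : 0 <= m%:Z by [].
have := ler_wpM2l m0 T; rewrite mulrDr.
rewrite PoszM; nia.
Qed.

(** Chernoff's method: with [z = 1 + 1 / m] and [kappa] the mean of [z] and [z^-1], the ratio of
    [z ^ drift] to [kappa ^ size] is a supermartingale. On the event, with drift [d], it is at least
    [(z / kappa ^ m) ^ d], exponentially large in [d]. *)
Lemma rare_drift (R : realType) b w (m : nat) : (1 < m)%N ->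
  rare R (fun s => ((size s)%:Z < m%:Z * drift b w s)).
Proof.
move=> m1; pose a : R := m%:R^-1.
have mR : 1 < m%:R :> R by rewrite ltr1n.
have a0 : 0 < a by rewrite invr_gt0; lra.
have a1 : a < 1 by rewrite invf_lt1; lra.
have ma : m%:R * a = 1 by rewrite divff; lra.
pose z := 1 + a; have z1 : 1 < z by rewrite /z; lra.
pose kappa := (z + z^-1) / 2.
have z0 : z != 0 by lra.
have kE : kappa = 1 + a ^+ 2 / (2 * z).
  by rewrite /kappa /z; field; rewrite -/z; lra.
have k1 : 1 <= kappa.
  by rewrite kE lerDl divr_ge0// ?sqr_ge0//; lra.
(* [kappa] exceeds 1 only by order [a ^ 2]: Bernoulli's inequality bounds [kappa ^ m] inversely by
   [1 - a / 2], and [(1 - a / 2) * (1 + a) > 1]. *)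
have kz : kappa ^+ m < z.
  have ik : 1 - a ^+ 2 / 2 <= kappa^-1.
    rewrite -[leRHS]mul1r ler_pdivlMr; last by lra.
    rewrite kE; have : 0 < z^-1 <= 1 by rewrite invr_gt0 invf_le1; lra.
    rewrite invfM => /andP[zi0 zi1]; have a2 : 0 < a ^+ 2 <= 1.
      by rewrite exprn_gt0// exprn_ile1//; lra.
    move: (z^-1) (a ^+ 2) zi0 zi1 a2 => x y *; nra.
  have bern j : (j%:R * (a ^+ 2 / 2) <= 1) -> 1 - j%:R * (a ^+ 2 / 2) <= kappa^-1 ^+ j.
    elim: j => [|j IH]; first by rewrite mul0r subr0 expr0.
    rewrite -natr1 => H.
    have y0 : 0 <= a ^+ 2 / 2 by rewrite divr_ge0// sqr_ge0.
    have j0 : 0 <= j%:R :> R by [].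
    rewrite [leRHS]exprS; have := IH ltac:(nra).
    have p0 : 0 <= kappa^-1 ^+ j by rewrite exprn_ge0// invr_ge0; lra.
    move: (a ^+ 2 / 2) (kappa^-1 ^+ j) (j%:R) ik y0 j0 p0 H => y x i; move: (kappa^-1) => c.
    move=> ik y0 j0 p0 H IHx.
    have iy0 : 0 <= i * y by rewrite mulr_ge0.
    have y2 : 0 <= 1 - y by lra.
    have cx : (1 - y) * x <= c * x by rewrite ler_wpM2r.
    have := ler_wpM2l y2 IHx; have := mulr_ge0 iy0 y0; lra.
  have mE : m%:R * (a ^+ 2 / 2) = a / 2 by rewrite expr2 !mulrA ma mul1r.
  have := bern m; rewrite mE => /(_ ltac:(lra)).
  rewrite exprVn => H.
  rewrite -(invrK (kappa ^+ m)) -(invrK z) ltf_pV2 ?posrE ?invr_gt0 ?exprn_gt0//; try lra.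
  apply: lt_le_trans H; rewrite -div1r ltr_pdivrMr; last by lra.
  rewrite /z; nra.
have k0 : 0 < kappa by lra.
have km0 : 0 < kappa ^+ m by rewrite exprn_gt0.
have [C C0 HC] := @cubic_le_expr R (z / kappa ^+ m) m ltac:(by rewrite ltr_pdivlMr// mul1r).
pose F s := z ^ drift b w s / kappa ^+ size s.
apply: (@rare_supermartingale R _ F C) => // [s|s|s].
- rewrite big_letter /F /= exprS.
  have y0 : 0 < z ^ drift b w s by rewrite exprz_gt0; lra.
  have x0 : 0 < (kappa ^+ size s)^-1 by rewrite invr_gt0 exprn_gt0.
  have kx : kappa * kappa^-1 = 1 by rewrite divff; lra.
  rewrite invfM !expfzDr//.
  (* Without [w] at the head the drift is unchanged and [kappa >= 1] suffices; with it, [z] and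
     [z^-1] average to exactly [kappa]. *)
  case: at_head; rewrite /bz ?mul0r ?expr0z ?mulr1 ?mul1r; last first.
    move: (z ^ _) (_^-1) x0 y0 => y x x0 y0.
    have ik : kappa^-1 <= 1 by rewrite invf_le1; lra.
    have : 0 <= y * x by rewrite mulr_ge0//; lra.
    nra.
  have zk : (z + z^-1) * kappa^-1 = 2 by rewrite /kappa; field; rewrite -?/kappa; nra.
  case: (b) y0 => /=; rewrite ?expr1z ?exprN1 => y0;
    move: (z ^ drift _ _ _) (kappa ^+ size s)^-1 => y x;
    rewrite le_eqVlt; apply/orP; left; apply/eqP;
    transitivity ((z + z^-1) / kappa * (2 * (y * x)));
    by [ring | rewrite zk; ring].
- by rewrite divr_ge0// ?exprz_ge0 ?exprn_ge0//; lra.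
- move=> H; have [d dE] : exists d : nat, drift b w s = d%:Z.
    case: (drift b w s) H => d H; [by exists d|exfalso; nia].
  rewrite /F dE; rewrite dE in H.
  have sz : (size s <= m * d)%N by lia.
  apply: (@le_trans _ _ (((m * d).+1 ^ 3)%:R)); first by rewrite ler_nat leq_exp2r// ltnS.
  apply: le_trans (HC d) _; rewrite ler_wpM2l// exprMn exprVn -exprM.
  rewrite -exprnP ler_wpM2l ?exprn_ge0//; first by lra.
  by rewrite lef_pV2 ?posrE ?exprn_gt0// ler_weXn2l.
Qed.

(** * Patterns and windows *)

Local Open Scope nat_scope.

Lemma card_ord_lt n (m : nat) : (m <= n)%N -> #|[set i : 'I_n | (i < m)%N]| = m.
Proof.
move=> mn; rewrite cardsE -sum1_card -(big_ord_widen_cond n xpredT (fun=> 1%N)) //.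
by rewrite sum_nat_const card_ord muln1.
Qed.

(** Each value of a permutation is the number of values below it, hence determined by the order. *)
Lemma perm_order_inj n (s t : 'S_n) :
  (forall a b, (s a < s b)%N = (t a < t b)%N) -> s = t.
Proof.
have rk (u : 'S_n) a : nat_of_ord (u a) = #|[set b | (u b < u a)%N]|.
  rewrite -{1}(card_ord_lt (ltnW (ltn_ord (u a)))).
  rewrite -(card_imset (mem [set b | (u b < u a)%N]) (@perm_inj _ u)).
  congr (#|pred_of_set _|); apply/setP => b; rewrite inE.
  apply/idP/imsetP => [H|[c]]; last by rewrite inE => H ->.
  by exists (u^-1 b)%g; rewrite ?inE ?permKV.
move=> E; apply/permP => a; apply: val_inj; rewrite /= (rk s a) (rk t a).
by apply: eq_card => b; rewrite !inE E.
Qed.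

Lemma sorted_enum_ord n (A : {pred 'I_n}) :
  sorted (fun i j : 'I_n => (i < j)%N) (enum A).
Proof.
have : sorted ltn (map val (enum 'I_n)) by rewrite val_enum_ord iota_ltn_sorted.
rewrite sorted_map enumT => H; rewrite /enum_mem.
by apply: sorted_filter H => x y z; exact: ltn_trans.
Qed.

(** Strictly increasing lists with the same elements are equal. *)
Lemma enum_val_incr n k (f : 'I_k -> 'I_n) (I : {set 'I_n}) (e : k = #|I|) :
  (forall a b : 'I_k, (a < b)%N -> (f a < f b)%N) -> I = [set f a | a : 'I_k] ->
  forall a, enum_val (cast_ord e a) = f a.
Proof.
move=> fincr fI a.
have E : enum I = map f (enum 'I_k).
  apply: (@irr_sorted_eq _ (fun i j : 'I_n => (i < j)%N)).
  - by move=> x y z; exact: ltn_trans.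
  - by move=> x; exact: ltnn.
  - exact: sorted_enum_ord.
  - by rewrite sorted_map; apply: sub_sorted (sorted_enum_ord _) => x y; exact: fincr.
  - move=> x; rewrite mem_enum fI; apply/imsetP/mapP.
      by move=> [b _ ->]; exists b; rewrite ?mem_enum.
    by move=> [b _ ->]; exists b.
rewrite (enum_val_nth (f a)) E /= (nth_map a) ?size_enum_ord// nth_ord_enum//.
Qed.

Lemma same_perm_pat n k (f : 'I_k -> 'I_n) (I : {set 'I_n}) (s : 'S_n) (pi : 'S_k) :
  (forall a b : 'I_k, (a < b)%N -> (f a < f b)%N) -> I = [set f a | a : 'I_k] ->
  same_perm (pat s I) pi = [forall a, forall b, (pi a < pi b)%N == (s (f a) < s (f b))%N].
Proof.
move=> fincr fI.
have finj : injective f.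
  move=> a b /(congr1 val) fab; apply: val_inj; case: (ltngtP a b) => // /fincr.
    by rewrite fab ltnn.
  by rewrite fab ltnn.
have e : k = #|I| by rewrite fI card_imset// card_ord.
have fE := enum_val_incr e fincr fI.
have patf a b : (pat s I (cast_ord e a) < pat s I (cast_ord e b))%N = (s (f a) < s (f b))%N.
  by rewrite patE !fE.
(* With the pattern generalized, the equation [k = #|I|] can be eliminated, so that both
   permutations have the same type. *)
move: (pat s I) patf; clear fE fI; case: _ / e => t patf.
rewrite /same_perm eq_Tagged /=; apply/eqP/forallP => [<- a|H].
  by apply/forallP => b; rewrite -patf !cast_ord_id.
apply: perm_order_inj => a b; move: (H a) => /forallP/(_ b)/eqP ->.
by rewrite -patf !cast_ord_id.
Qed.

Lemma Av321P n (s : 'S_n) :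
  reflect (forall i j l : 'I_n, (i < j < l)%N -> ~~ (s l < s j < s i)%N)
    (s \in Av (decr 3) n).
Proof.
rewrite inE /avoids; apply: (iffP idP) => [H i j l /andP[ij jl]|H].
  apply: contra H => /andP[slj sji]; apply/existsP.
  pose f (a : 'I_3) := tnth [tuple i; j; l] a.
  exists [set f a | a : 'I_3].
  rewrite (@same_perm_pat _ _ f)//; last first.
    by move=> [[|[|[|a]]] ha] [[|[|[|b]]] hb] //= _; rewrite /f /tnth /=; lia.
  apply/forallP => -[[|[|[|a]]] ha] //; apply/forallP => -[[|[|[|b]]] hb] //;
    rewrite !permE /f /tnth /=; apply/eqP; lia.
apply/negP => /existsP[I]; move=> HI.
have e : #|I| = 3 by move: HI => /eqP/(congr1 tag).
pose f (a : 'I_3) := enum_val (cast_ord (esym e) a).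
have fincr (a b : 'I_3) : (a < b)%N -> (f a < f b)%N.
  move=> ab; rewrite /f.
  rewrite !(enum_val_nth (f a)).
  apply: (sorted_ltn_nth _ _ (sorted_enum_ord I)) => //=; rewrite ?inE -?cardE ?e//.
  by move=> x y z; exact: ltn_trans.
have fI : I = [set f a | a : 'I_3].
  apply/setP => x; apply/idP/imsetP => [xI|[a _ ->]]; last exact: enum_valP.
  by exists (cast_ord e (enum_rank_in xI x)); rewrite // /f cast_ordK enum_rankK_in.
rewrite (same_perm_pat _ _ fincr fI) in HI.
pose o0 := @Ordinal 3 0 isT; pose o1 := @Ordinal 3 1 isT; pose o2 := @Ordinal 3 2 isT.
have /negP := H (f o0) (f o1) (f o2) ltac:(by rewrite !fincr).
apply; move: HI => /forallP HI.
have /forallP/(_ o1)/eqP := HI o2; have /forallP/(_ o0)/eqP := HI o1.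
by rewrite !permE /= => <- <-.
Qed.

(** * Monotonicity on weak excedances and on the other positions *)

Section Code.
Variables (n : nat) (s : 'S_n).

Definition wexc (i : 'I_n) : bool := (i <= s i)%N.

Definition wexc_val (i : 'I_n) : bool := ((s^-1)%g i <= i)%N.

Lemma wexc_valE i : wexc_val (s i) = wexc i.
Proof. by rewrite /wexc_val permK. Qed.

Hypothesis s_av : s \in Av (decr 3) n.

(* The values below [s j] cannot all sit left of [j], so one of them completes a 321. *)
Lemma wexc_incr (i j : 'I_n) : wexc i -> wexc j -> (i < j)%N -> (s i < s j)%N.
Proof.
move=> wi wj ij; rewrite ltnNge; apply/negP => sji.
have {}sji : (s j < s i)%N.
  rewrite ltn_neqAle sji andbT; apply/eqP => /val_inj/perm_inj E.
  by rewrite E ltnn in ij.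
suff [l jl sl] : exists2 l : 'I_n, (j < l)%N & (s l < s j)%N.
  by have /negP := Av321P _ s_av i j l ltac:(by rewrite ij); apply; rewrite sl.
apply/exists_inP; apply: contraT; rewrite negb_exists_in => /forall_inP H.
have : #|[set l : 'I_n | (s l < s j)%N]| <= #|[set l : 'I_n | (l < j)%N] :\ i|.
  apply: subset_leq_card; apply/fintype.subsetP => l; rewrite !inE => sl.
  rewrite ltnNge; apply/andP; split; first by apply/eqP => E; rewrite E in sl; lia.
  rewrite leq_eqVlt; apply/norP; split.
    by apply/eqP => /val_inj E; rewrite E ltnn in sl.
  by apply/negP => /H; rewrite sl.
have := cardsD1 i [set l : 'I_n | (l < j)%N]; rewrite inE ij.
rewrite card_ord_lt ?(ltnW (ltn_ord j))// => E.
have -> : [set l : 'I_n | (s l < s j)%N] = s @^-1: [set l : 'I_n | (l < s j)%N].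
  by apply/setP => l; rewrite !inE.
rewrite (card_preimset _ (@perm_inj _ s)) card_ord_lt ?(ltnW (ltn_ord _))//.
move: wj; rewrite /wexc; lia.
Qed.

(** Fewer values lie below [s i] than positions left of [i], so some position left of [i] carries a
    larger value and completes a 321. *)
Lemma wexcN_incr (i j : 'I_n) : ~~ wexc i -> ~~ wexc j -> (i < j)%N -> (s i < s j)%N.
Proof.
move=> wi wj ij; rewrite ltnNge; apply/negP => sji.
have {}sji : (s j < s i)%N.
  rewrite ltn_neqAle sji andbT; apply/eqP => /val_inj/perm_inj E.
  by rewrite E ltnn in ij.
suff [l jl sl] : exists2 l : 'I_n, (l < i)%N & (s i < s l)%N.
  by have /negP := Av321P _ s_av l i j ltac:(by rewrite jl); apply; rewrite sl sji.
apply/exists_inP; apply: contraT; rewrite negb_exists_in => /forall_inP H.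
have : #|[set l : 'I_n | (l < i)%N]| <= #|[set l : 'I_n | (s l < s i)%N]|.
  apply: subset_leq_card; apply/fintype.subsetP => l; rewrite !inE => li.
  have := H _ li; rewrite -leqNgt leq_eqVlt => /orP[/eqP/val_inj/perm_inj E|//].
  by rewrite E ltnn in li.
have -> : [set l : 'I_n | (s l < s i)%N] = s @^-1: [set l : 'I_n | (l < s i)%N].
  by apply/setP => l; rewrite !inE.
rewrite (card_preimset _ (@perm_inj _ s)) !card_ord_lt ?(ltnW (ltn_ord _))//.
move: wi; rewrite /wexc; lia.
Qed.

End Code.

(** * The word of weak excedances *)

Local Open Scope ring_scope.

Definition exc_word n (s : 'S_n) : n.-tuple letter :=
  [tuple (wexc s i, wexc_val s i) | i < n].

Lemma rank_inj n (V : {set 'I_n}) :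
  {in V &, injective (fun x : 'I_n => #|[set z in V | (z < x)%N]|)}.
Proof.
suff lt (x y : 'I_n) : x \in V -> (x < y)%N ->
    (#|[set z in V | (z < x)%N]| < #|[set z in V | (z < y)%N]|)%N.
  move=> x y xV yV E; apply: val_inj => /=; case: (ltngtP x y) => //.
    by move/(lt _ _ xV); rewrite E ltnn.
  by move/(lt _ _ yV); rewrite E ltnn.
move=> xV xy; apply: proper_card; apply/properP; split.
  by apply/fintype.subsetP => z; rewrite !inE => /andP[-> /ltn_trans]; apply.
by exists x; rewrite !inE xV ?xy ?ltnn.
Qed.

Lemma rank_incr n (s : 'S_n) (A : {set 'I_n}) (i : 'I_n) :
  {in A &, forall i j : 'I_n, (i < j)%N -> (s i < s j)%N} -> i \in A ->
  #|[set y in s @: A | (y < s i)%N]| = #|[set j in A | (j < i)%N]|.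
Proof.
move=> sA iA; rewrite -[RHS](card_imset _ (@perm_inj _ s)).
apply: eq_card => y; rewrite inE; apply/andP/imsetP.
  move=> [/imsetP[j jA ->] sji]; exists j => //; rewrite inE jA /=.
  rewrite ltnNge leq_eqVlt; apply/norP; split.
    by apply/eqP => /val_inj E; rewrite E ltnn in sji.
  by apply/negP => /(sA _ _ iA jA) /ltn_trans/(_ sji); rewrite ltnn.
by move=> [j /setIdP[jA ji] ->]; split; [exact: imset_f|exact: sA].
Qed.

(** The word gives the columns and the rows of the weak excedances; the permutation is the
    increasing bijection between these sets and between their complements, so ranks recover its
    values. *)
Lemma exc_word_inj n : {in Av (decr 3) n &, injective (@exc_word n)}.
Proof.
move=> s t sav tav E.
have Ei i : (wexc s i, wexc_val s i) = (wexc t i, wexc_val t i).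
  by have := congr1 (fun c => tnth c i) E; rewrite !tnth_mktuple.
have imE (u : 'S_n) : u @: [set i | wexc u i] = [set y | wexc_val u y].
  apply/setP => y; rewrite inE; apply/imsetP/idP => [[i]|H].
    by rewrite inE => H ->; rewrite wexc_valE.
  by exists (u^-1 y)%g; rewrite ?inE -?wexc_valE ?permKV.
have imN (u : 'S_n) : u @: [set i | ~~ wexc u i] = [set y | ~~ wexc_val u y].
  apply/setP => y; rewrite inE; apply/imsetP/idP => [[i]|H].
    by rewrite inE => H ->; rewrite wexc_valE.
  by exists (u^-1 y)%g; rewrite ?inE -?wexc_valE ?permKV.
have incr (u : 'S_n) : u \in Av (decr 3) n ->
    {in [set i | wexc u i] &, forall i j : 'I_n, (i < j)%N -> (u i < u j)%N}.
  by move=> uav i j; rewrite !inE; exact: wexc_incr.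
have incrN (u : 'S_n) : u \in Av (decr 3) n ->
    {in [set i | ~~ wexc u i] &, forall i j : 'I_n, (i < j)%N -> (u i < u j)%N}.
  by move=> uav i j; rewrite !inE; exact: wexcN_incr.
have pE : [set i | wexc s i] = [set i | wexc t i].
  by apply/setP => i; rewrite !inE; case: (Ei i).
have pN : [set i | ~~ wexc s i] = [set i | ~~ wexc t i].
  by apply/setP => i; rewrite !inE; case: (Ei i) => ->.
have vE : [set i | wexc_val s i] = [set i | wexc_val t i].
  by apply/setP => i; rewrite !inE; case: (Ei i).
have vN : [set i | ~~ wexc_val s i] = [set i | ~~ wexc_val t i].
  by apply/setP => i; rewrite !inE; case: (Ei i) => _ ->.
apply/permP => i; case: (boolP (wexc s i)) => wi.
  have wti : wexc t i by case: (Ei i) => <-.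
  have siV : s i \in [set y | wexc_val s y] by rewrite inE wexc_valE.
  have tiV : t i \in [set y | wexc_val s y] by rewrite vE inE wexc_valE.
  apply: (rank_inj siV tiV); rewrite -{1}imE vE -imE.
  by rewrite (rank_incr (incr _ sav)) ?(rank_incr (incr _ tav)) ?inE// pE.
have wti : ~~ wexc t i by case: (Ei i) => <-.
have siV : s i \in [set y | ~~ wexc_val s y] by rewrite inE wexc_valE.
have tiV : t i \in [set y | ~~ wexc_val s y] by rewrite vN inE wexc_valE.
apply: (rank_inj siV tiV); rewrite -{1}imN vN -imN.
by rewrite (rank_incr (incrN _ sav)) ?(rank_incr (incrN _ tav)) ?inE// pN.
Qed.

Definition crossing n (s : 'S_n) (i : nat) : nat := #|[set j : 'I_n | (j < i <= s j)%N]|.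

(** Both sides count the points with [j <= i <= s j]: one splits off the point in column [i], the
    other the point in row [i]. *)
Lemma crossing_step n (s : 'S_n) (i : 'I_n) :
  (crossing s i + wexc s i = crossing s i.+1 + wexc_val s i)%N.
Proof.
pose D := [set j : 'I_n | (j <= i <= s j)%N].
transitivity #|D|.
  rewrite (cardsD1 i D) inE leqnn addnC; congr (_ + _)%N.
  apply: eq_card => j; rewrite !inE ltn_neqAle -andbA.
  by congr (~~ _ && _); apply/eqP/eqP => [/val_inj|->].
rewrite (cardsD1 (s^-1 i)%g D) inE permKV leqnn andbT addnC; congr (_ + _)%N.
apply: eq_card => j; rewrite !inE ltnS (ltn_neqAle i).
have -> : (j != (s^-1)%g i) = (nat_of_ord i != s j).
  by congr (~~ _); apply/eqP/eqP => [->|/val_inj ->]; rewrite ?permKV ?permK.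
by rewrite andbCA.
Qed.

(** Downward induction on [i] from [n], where both sides vanish; [crossing_step] matches the
    recursion of [height]. *)
Lemma height_exc_word n (s : 'S_n) i : (i <= n)%N ->
  height (drop i (exc_word s)) = (crossing s i)%:Z.
Proof.
move=> i_n; rewrite -(subKn i_n); move: (n - i)%N (leq_subr i n) => d {i i_n}.
elim: d => [|d IH] dn.
  rewrite subn0 drop_oversize ?size_tuple//= /crossing eq_card0// => j.
  by apply/negP; rewrite inE => /andP[_]; rewrite leqNgt ltn_ord.
have lt : (n - d.+1 < n)%N by lia.
pose i := Ordinal lt.
rewrite (drop_nth (false, false)) ?size_tuple//=.
rewrite (_ : (n - d.+1).+1 = n - d)%N; last by lia.
rewrite IH ?(ltnW dn)//; have := crossing_step s i => /=.
rewrite (_ : (n - d.+1).+1 = n - d)%N; last by lia.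
have -> : nth (false, false) (exc_word s) (n - d.+1) = (wexc s i, wexc_val s i).
  by have := tnth_nth (false, false) (exc_word s) i; rewrite tnth_mktuple => ->.
rewrite /bz /=; lia.
Qed.

Lemma nonnegE s :
  nonneg s = all (fun i => 0 <= height (drop i s)) (iota 0 (size s).+1).
Proof.
elim: s => [//|a s IH].
have -> : iota 0 (size (a :: s)).+1 = 0%N :: map succn (iota 0 (size s).+1).
  by rewrite -(iotaDl 1 0).
rewrite [nonneg _]/= IH; move: (iota 0 _) => r.
by rewrite [RHS]/= all_map.
Qed.

Lemma nonneg_exc_word n (s : 'S_n) : nonneg (exc_word s).
Proof.
rewrite nonnegE size_tuple; apply/allP => i; rewrite mem_iota => /andP[_ i_n].
by rewrite height_exc_word.
Qed.

Lemma lowE K s : low K s = (\sum_(i < size s) (height (drop i.+1 s) <= K%:Z)%R)%N.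
Proof.
by elim: s => [|a s IH]; rewrite ?big_ord0// big_ord_recl /= drop0 IH.
Qed.

Lemma cntE w s : cnt w s = (\sum_(i < (size s).+1) at_head w (drop i s))%N.
Proof.
elim: s => [|a s IH]; first by rewrite big_ord_recl big_ord0.
by rewrite big_ord_recl /= IH.
Qed.

(** * Consecutive occurrences *)

Local Open Scope nat_scope.

(** A total function on [nat], so that shifted positions [i + a] carry no bound proof; the default 0
    is excluded by [i + k <= n] in [occ_at]. *)
Definition value n (s : 'S_n) (i : nat) : nat := nth 0%N [seq val (s j) | j : 'I_n] i.

Lemma valueE n (s : 'S_n) (j : 'I_n) : value s j = s j.
Proof. by rewrite /value (nth_map j) ?size_enum_ord// nth_ord_enum. Qed.

Definition occ_at k n (pi : 'S_k) (s : 'S_n) (i : nat) : bool :=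
  (i + k <= n)%N && [forall a : 'I_k, forall b : 'I_k,
    (pi a < pi b)%N == (value s (i + a) < value s (i + b))%N].

Lemma card_ord_itv n (i k : nat) : (i + k <= n)%N ->
  #|[set j : 'I_n | (i <= j < i + k)%N]| = k.
Proof.
move=> ikn; have ik : [set j : 'I_n | (j < i)%N] \subset [set j : 'I_n | (j < i + k)%N].
  by apply/fintype.subsetP => j; rewrite !inE; lia.
have -> : [set j : 'I_n | (i <= j < i + k)%N] =
    [set j : 'I_n | (j < i + k)%N] :\: [set j : 'I_n | (j < i)%N].
  by apply/setP => j; rewrite !inE -leqNgt.
rewrite cardsD (finset.setIidPr ik) !card_ord_lt//; lia.
Qed.

(** A nonempty interval of size [k] is determined by its first element. *)
Lemma cocc_sum k n (pi : 'S_k) (s : 'S_n) : (0 < k)%N ->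
  cocc pi s = \sum_(i < n) occ_at pi s i.
Proof.
move=> k0; have -> : \sum_(i < n) occ_at pi s i = #|[set i : 'I_n | occ_at pi s i]|.
  by rewrite -sum1dep_card [RHS]big_mkcond.
rewrite /cocc.
pose W (i : 'I_n) := [set j : 'I_n | (i <= j < i + k)%N].
have Wocc (i : 'I_n) : (i + k <= n)%N ->
    same_perm (pat s (W i)) pi = occ_at pi s i.
  move=> ikn; have lt (a : 'I_k) : (i + a < n)%N.
    by apply: leq_trans ikn; rewrite ltn_add2l.
  pose f a := Ordinal (lt a).
  rewrite (@same_perm_pat _ _ f); first last.
  - apply/setP => j; rewrite inE; apply/idP/imsetP => [/andP[ij jk]|[a _ ->]].
      have jik : (j - i < k)%N by lia.
      by exists (Ordinal jik) => //; apply: val_inj; rewrite /= subnKC.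
    by rewrite /= leq_addr ltn_add2l ltn_ord.
  - by move=> a b ab; rewrite /= ltn_add2l.
  rewrite /occ_at ikn; apply: eq_forallb => a; apply: eq_forallb => b.
  by rewrite -!valueE.
rewrite -[RHS](@card_in_imset _ _ W).
  apply: eq_card => I; rewrite inE; apply/and3P/imsetP => [[]|[i]].
    move=> /existsP[a /existsP[b /eqP IE]] /eqP Ik Ipi.
    have ab : (a <= b)%N.
      rewrite leqNgt; apply/negP => ba; suff I0 : I = finset.set0.
        by rewrite -Ik I0 cards0 in k0.
      by apply/setP => j; rewrite IE !inE; lia.
    have kE : (a + k = b.+1)%N.
      have := @card_ord_itv n a (b.+1 - a)%N.
      have -> : [set j : 'I_n | (a <= j < a + (b.+1 - a))%N] = I.
        by rewrite IE; apply/setP => j; rewrite !inE; lia.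
      by rewrite Ik; have := ltn_ord b; lia.
    have IW : I = W a.
      by rewrite IE; apply/setP => j; rewrite !inE; lia.
    exists a => //; rewrite inE -Wocc -?IW//; have := ltn_ord b; lia.
  rewrite inE => occ ->; have /andP[ikn _] := occ.
  split; last by rewrite Wocc.
    have lt : (i + k.-1 < n)%N by lia.
    apply/existsP; exists i; apply/existsP; exists (Ordinal lt).
    by apply/eqP/setP => j; rewrite !inE /=; lia.
  by rewrite card_ord_itv.
move=> i j; rewrite !inE => /andP[ikn _] /andP[jkn _] /setP E.
have := E i; have := E j; rewrite !inE; move=> Ej Ei.
by apply: val_inj => /=; lia.
Qed.

(** * Reading the pattern of a window from its word *)

Definition word_lt (w : seq bool) (a b : nat) : bool :=
  let x := nth false w a in let y := nth false w b in
  (~~ x && y) || ((x == y) && (a < b)%N).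

(* Letters [false] become the small values, letters [true] the large ones, each in
   increasing order. *)
Definition induces k (pi : 'S_k) (w : seq bool) : bool :=
  [forall a : 'I_k, forall b : 'I_k, (pi a < pi b)%N == word_lt w a b].

(** Otherwise [s a <= s b < b]. The points crossing at [a] are weak excedances left of [a], so their
    values lie between [a] and [b], which leaves room for fewer than [k] of them. *)
Lemma crossing_window n (s : 'S_n) k (a b : 'I_n) : s \in Av (decr 3) n ->
  wexc s a -> ~~ wexc s b -> (b < a + k)%N -> (k < crossing s a)%N ->
  (s b < s a)%N.
Proof.
move=> sav wa wb bk ck; rewrite ltnNge; apply/negP => sab.
have sbb : (s b < b)%N by rewrite ltnNge.
have lt_ab : (a < b)%N.
  exact: leq_ltn_trans wa (leq_ltn_trans sab sbb).
have : crossing s a <= #|[set y : 'I_n | (a <= y < a + (b - a))%N]|; last first.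
  rewrite card_ord_itv; first by lia.
  by rewrite subnKC ?(ltnW lt_ab)// ltnW.
rewrite /crossing -(card_imset _ (@perm_inj _ s)); apply: subset_leq_card.
apply/fintype.subsetP => y /imsetP[j]; rewrite !inE => /andP[ja asj] ->.
have wj : wexc s j by exact: leq_trans (ltnW ja) asj.
have := wexc_incr sav wj wa ja; lia.
Qed.

Lemma nth_at_head n (s : 'S_n) (w : seq bool) (i a : nat) :
  at_head w (drop i (exc_word s)) -> (a < size w)%N ->
  exists2 j : 'I_n, nat_of_ord j = (i + a)%N & nth false w a = wexc s j.
Proof.
move=> /prefixP[r E] aw.
have sz : (i + a < n)%N.
  have := congr1 size E; rewrite size_map size_drop size_tuple size_cat => En.
  by rewrite -ltn_subRL En ltn_addr.
exists (Ordinal sz) => //.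
have -> : nth false w a = nth false (unzip1 (drop i (exc_word s))) a.
  by rewrite E nth_cat aw.
rewrite (nth_map (false, false)) ?size_drop ?size_tuple; last by lia.
rewrite nth_drop; have := tnth_nth (false, false) (exc_word s) (Ordinal sz).
by rewrite tnth_mktuple /= => <-.
Qed.

(** Equal letters are ordered by position, by monotonicity on each class; for distinct letters,
    [crossing_window] puts the weak excedance on top. *)
Lemma occ_at_induces n (s : 'S_n) k (pi : 'S_k) (w : seq bool) (i : nat) :
  s \in Av (decr 3) n -> (i + k <= n)%N -> size w = k ->
  (forall d, (d < k)%N -> (k < crossing s (i + d))%N) ->
  at_head w (drop i (exc_word s)) -> occ_at pi s i = induces pi w.
Proof.
move=> sav ikn wk hi wi; rewrite /occ_at ikn /=.
apply: eq_forallb => a; apply: eq_forallb => b; congr (_ == _).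
have aw : (a < size w)%N by rewrite wk.
have bw : (b < size w)%N by rewrite wk.
have [ja jaE wa] := nth_at_head wi aw; have [jb jbE wb] := nth_at_head wi bw.
rewrite -jaE -jbE !valueE /word_lt wa wb.
have ca : (k < crossing s ja)%N by rewrite jaE hi.
have cb : (k < crossing s jb)%N by rewrite jbE hi.
have ak := ltn_ord a; have bk := ltn_ord b.
case: (boolP (wexc s ja)) => pa; case: (boolP (wexc s jb)) => pb /=.
- case: (ltngtP a b) => ab.
  + by apply: wexc_incr => //; lia.
  + by apply/negbTE; rewrite -leqNgt ltnW// wexc_incr//; lia.
  + by rewrite (_ : ja = jb) ?ltnn//; apply: val_inj; rewrite /= jaE jbE ab.
- by apply/negbTE; rewrite -leqNgt ltnW// (crossing_window sav pa pb _ ca)//; lia.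
- by rewrite (crossing_window sav pb pa _ cb)//; lia.
- case: (ltngtP a b) => ab.
  + by apply: wexcN_incr => //; lia.
  + by apply/negbTE; rewrite -leqNgt ltnW// wexcN_incr//; lia.
  + by rewrite (_ : ja = jb) ?ltnn//; apply: val_inj; rewrite /= jaE jbE ab.
Qed.

Definition low_at n (s : 'S_n) (k i : nat) : bool := (i < n)%N && (crossing s i <= k)%N.

(** Only one word of length [k] can head the suffix, so [h] is 0 or 1. It equals [occ_at] unless the
    window contains a low position, and then [B >= 1] covers the error. *)
Lemma occ_at_dev n (s : 'S_n) k (pi : 'S_k) (i : nat) (B := \sum_(d < k) low_at s k (i + d))
    (h := \sum_(w : k.-tuple bool | induces pi w) at_head w (drop i (exc_word s))) :
  s \in Av (decr 3) n -> (0 < k)%N -> (occ_at pi s i <= h + B /\ h <= occ_at pi s i + B)%N.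
Proof.
move=> sav k0; case: (leqP (i + k) n) => ikn; last first.
  have -> : h = 0%N.
    rewrite /h big1// => w _; case: (boolP (at_head w _)) => // wi; exfalso.
    have kw : (k.-1 < size w)%N by rewrite size_tuple prednK.
    by have [j jE _] := nth_at_head wi kw; have := ltn_ord j; lia.
  by rewrite /occ_at [(i + k <= n)%N]leqNgt ikn.
have sz : size (take k (unzip1 (drop i (exc_word s)))) == k.
  by rewrite size_takel// size_map size_drop size_tuple; lia.
pose w0 := Tuple sz.
have w0E (w : k.-tuple bool) : at_head w (drop i (exc_word s)) = (w == w0).
  by rewrite /at_head prefixE size_tuple eq_sym -val_eqE.
have -> : h = induces pi w0.
  rewrite /h (eq_bigr (fun w => (w == w0) : nat)); last by move=> w _; rewrite w0E.
  case: (boolP (induces pi w0)) => iw0.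
    by rewrite (bigD1 w0)// eqxx big1 ?addn0// => w /andP[_ /negbTE ->].
  rewrite big1// => w iw; case: eqP => // E.
  by rewrite -E iw in iw0.
case: (posnP B) => [B0|B0]; last first.
  by split; apply: leq_trans (leq_addl _ B); apply: leq_trans (leq_b1 _) B0.
rewrite (@occ_at_induces n s k pi w0 i)// ?size_tuple ?w0E//; first by split; exact: leq_addr.
move=> d dk; rewrite ltnNge; apply/negP => cd.
have : (0 < B)%N; last by rewrite B0.
rewrite /B (bigD1 (Ordinal dk))//= /low_at cd (_ : (i + d < n)%N)//; lia.
Qed.

(** [low] inspects positions 1 to [n], so position 0 costs the extra 1. Shifting by [d] adds
    nothing, as positions from [n] on are not low. *)
Lemma sum_low_at n (s : 'S_n) k d :
  (\sum_(i < n) low_at s k (i + d) <= (low k (exc_word s)).+1)%N.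
Proof.
have lowS : (\sum_(i < n.+1) (crossing s i <= k) <= (low k (exc_word s)).+1)%N.
  rewrite big_ord_recl lowE size_tuple; apply: (@leq_add _ _ 1); first exact: leq_b1.
  apply: leq_sum => i _ /=; rewrite height_exc_word//.
apply: leq_trans lowS.
have -> : (\sum_(i < n) low_at s k (i + d) = \sum_(d <= i < n + d) low_at s k i)%N.
  by rewrite -{2}[d]add0n big_addn addnK big_mkord.
have H a b : (\sum_(a <= i < b) low_at s k i <= \sum_(i < n.+1) (crossing s i <= k))%N.
  apply: (@leq_trans (\sum_(0 <= i < n.+1 + b) low_at s k i)).
    case: (leqP a b) => ab; last by rewrite big_geq// ltnW.
    rewrite [leqRHS](@big_cat_nat _ _ _ a)//=; last by lia.
    rewrite (@big_cat_nat _ _ _ b a (n.+1 + b))//=; last by lia.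
    lia.
  rewrite (@big_cat_nat _ _ _ n.+1)//=; last by lia.
  rewrite [X in (_ + X)%N]big1_seq ?addn0; last first.
    by move=> i; rewrite mem_index_iota /low_at => H; rewrite (_ : (i < n)%N = false)//; lia.
  rewrite big_mkord; apply: leq_sum => i _; rewrite /low_at.
  by case: (i < n)%N.
exact: H.
Qed.

(** A low position spoils at most [k] windows. *)
Lemma cocc_dev n (s : 'S_n) k (pi : 'S_k) :
  s \in Av (decr 3) n -> (0 < k)%N ->
  (`|(cocc pi s)%:Z -
     (\sum_(w : k.-tuple bool | induces pi w) cnt w (exc_word s))%:Z|
   <= (k * (low k (exc_word s)).+1)%:Z)%R.
Proof.
move=> sav k0; have := sum_low_at s k; move: (low k _) => L HL.
have cE (w : k.-tuple bool) :
    cnt w (exc_word s) = \sum_(i < n) at_head w (drop i (exc_word s)).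
  rewrite cntE size_tuple big_ord_recr /= drop_oversize ?size_tuple ?card_ord//.
  case: (boolP (at_head w [::])) => [/size_prefix|]; last by rewrite addn0.
  by rewrite size_tuple leqNgt k0.
rewrite (cocc_sum pi s k0) (eq_bigr _ (fun w _ => cE w)) exchange_big /=.
have HB : (\sum_(i < n) \sum_(d < k) low_at s k (i + d) <= k * L.+1)%N.
  rewrite exchange_big /= -[k in (k * _)%N]card_ord -sum_nat_const.
  by apply: leq_sum => d _; exact: HL.
have H1 : (\sum_(i < n) occ_at pi s i <=
    \sum_(i < n) \sum_(w : k.-tuple bool | induces pi w) at_head w (drop i (exc_word s))
    + \sum_(i < n) \sum_(d < k) low_at s k (i + d))%N.
  by rewrite -big_split; apply: leq_sum => i _; case: (occ_at_dev pi i sav k0).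
have H2 : (\sum_(i < n) \sum_(w : k.-tuple bool | induces pi w) at_head w (drop i (exc_word s))
    <= \sum_(i < n) occ_at pi s i
    + \sum_(i < n) \sum_(d < k) low_at s k (i + d))%N.
  by rewrite -big_split; apply: leq_sum => i _; case: (occ_at_dev pi i sav k0).
move: H1 H2 HB; set x := (\sum_(i < n) occ_at _ _ _)%N.
set y := (\sum_(i < n) \sum_(w : k.-tuple bool | _) _)%N.
set z := (\sum_(i < n) \sum_(d < k) _)%N.
move: x y z => x y z *; lia.
Qed.

(** * A lower bound on the number of 321-avoiding permutations *)

(* Dyck paths of length [2n]: from the right, a letter is an up or down step for its
   second component followed by a down or up step for its first one. *)
Fixpoint dyck (s : seq letter) : bool :=
  if s is a :: s' then
    [&& dyck s', (0 <= height s)%R & a.1 || (0 < height s)%R]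
  else true.

Definition ballot (n h : nat) : nat :=
  \sum_(t : n.-tuple letter) (dyck t && (height t == Posz h)).

Lemma dyck_height_ge0 s : dyck s -> (0 <= height s)%R.
Proof. by case: s => //= a s /and3P[]. Qed.

Lemma ballot_step n h : ballot n.+1 h =
  (ballot n h + ballot n h.+1 + if h is h'.+1 then ballot n h + ballot n h' else 0)%N.
Proof.
rewrite /ballot (big_tuple_cons _ _ (fun t => nat_of_bool (dyck t && (height t == Posz h)))).
rewrite big_letter /= -!addnA; congr (_ + _)%N.
  apply: eq_bigr => t _; congr nat_of_bool; rewrite /bz /= andbT.
  by case: (boolP (dyck t)) => // /dyck_height_ge0 ?; lia.
congr (_ + _)%N.
  apply: eq_bigr => t _; congr nat_of_bool; rewrite /bz /= andbT.
  by case: (boolP (dyck t)) => // /dyck_height_ge0 ?; lia.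
case: h => [|h].
  rewrite !big1// => t _; rewrite /bz /=;
    by case: (boolP (dyck t)) => // /dyck_height_ge0 ?; lia.
rewrite addnC; congr (_ + _)%N.
  apply: eq_bigr => t _; congr nat_of_bool; rewrite /bz /=.
  by case: (boolP (dyck t)) => // /dyck_height_ge0 ?; lia.
apply: eq_bigr => t _; congr nat_of_bool; rewrite /bz /=.
by case: (boolP (dyck t)) => // /dyck_height_ge0 ?; lia.
Qed.

(** The reflection formula for ballot numbers, kept free of truncated subtraction. Pascal's rule
    applied twice matches [ballot_step]; at height 0 the symmetry of binomial coefficients replaces
    the missing neighbour. *)
Lemma ballotE n h : (ballot n h + 'C(2 * n, (n + h).+1) = 'C(2 * n, n + h))%N.
Proof.
elim: n h => [|n IH] h.
  rewrite /ballot (eq_bigr (fun=> nat_of_bool (h == 0)%N)); last first.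
    by move=> t _; rewrite tuple0 /=; case: h.
  by rewrite sum_nat_const card_tuple; case: h => [|h].
have two m : 'C(2 * n.+1, m.+2) = ('C(2 * n, m.+2) + 2 * 'C(2 * n, m.+1) + 'C(2 * n, m))%N.
  by rewrite mulnS !binS; lia.
rewrite ballot_step; have := IH h; have := IH h.+1.
rewrite addSn addnS two.
case: h => [|h].
  rewrite addn0; case: n IH two => [|n] IH two.
    by rewrite !(muln0, muln1, bin0n, bin1) /=; lia.
  rewrite two; have : 'C(2 * n.+1, n) = 'C(2 * n.+1, n.+2).
    by rewrite -bin_sub; [congr 'C(_, _); lia|lia].
  by lia.
have := IH h; rewrite addnS two; lia.
Qed.

(** [ballot n 0] is the Catalan number, the central binomial coefficient over [n + 1]; that
    coefficient is at least [4 ^ n / (2 * n + 1)]. *)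
Lemma ballot_ge n : (4 ^ n <= (n.+1 * (2 * n).+1) * ballot n 0)%N.
Proof.
have central m : (m.+1 * 'C(2 * m.+1, m.+1) = 2 * (2 * m).+1 * 'C(2 * m, m))%N.
  have := mul_bin_diag (2 * m).+1 m; have := mul_bin_down (2 * m).+1 m.
  rewrite mulnS /= => H1 H2.
  have := mul_bin_diag (2 * m) m.
  have : 'C(2 * m.+1, m.+1) = (2 * 'C((2 * m).+1, m))%N.
    rewrite mulnS binS -[in X in (X + _)%N]bin_sub; last by lia.
    rewrite (_ : (2 * m).+1 - m.+1 = m)%N; lia.
  by rewrite mulnS; lia.
have H m : (4 ^ m <= (2 * m).+1 * 'C(2 * m, m))%N.
  elim: m => [|m IH]; first by rewrite bin0.
  have := central m; rewrite expnS; nia.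
apply: leq_trans (H n) _; rewrite mulnAC mulnC leq_mul2r /=.
have := ballotE n 0; rewrite addn0.
have := mul_bin_left (2 * n) n; rewrite (_ : 2 * n - n = n)%N; last by lia.
nia.
Qed.

(** * From Dyck words to permutations *)

Lemma exists_perm_of_sets n (A V : {set 'I_n}) : #|A| = #|V| ->
  exists s : 'S_n, [/\ forall i, (s i \in V) = (i \in A),
    {in A &, forall i j : 'I_n, (i < j)%N -> (s i < s j)%N} &
    {in ~: A &, forall i j : 'I_n, (i < j)%N -> (s i < s j)%N}].
Proof.
move=> AV.
(* [g] sends the element of [B] of a given rank to the element of [U] of the same rank; the default
   of [nth] is not reached when the sizes agree. *)
pose g (B U : {set 'I_n}) i := nth i (enum U) (index i (enum B)).
have gU (B U : {set 'I_n}) i : #|B| = #|U| -> i \in B -> g B U i \in U.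
  by move=> BU iB; rewrite -mem_enum mem_nth// -cardE -BU cardE index_mem mem_enum.
have glt (B U : {set 'I_n}) : #|B| = #|U| ->
    {in B &, forall i j : 'I_n, (i < j)%N -> (g B U i < g B U j)%N}.
  move=> BU i j iB jB ij; rewrite /g (set_nth_default i) -?cardE -?BU ?cardE ?index_mem ?mem_enum//.
  have tr : transitive (fun i j : 'I_n => (i < j)%N) by move=> x y z; exact: ltn_trans.
  apply: (sorted_ltn_nth tr _ (sorted_enum_ord U));
    rewrite ?inE -?cardE -?BU ?cardE ?index_mem ?mem_enum//.
  rewrite ltnNge leq_eqVlt; apply/norP; split.
    apply/eqP => /(congr1 (nth i (enum B))); rewrite !nth_index ?mem_enum// => E.
    by rewrite E ltnn in ij.
  apply/negP => /(sorted_ltn_index tr (sorted_enum_ord B)).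
  by rewrite !mem_enum => /(_ jB iB) /(ltn_trans ij); rewrite ltnn.
have AVC : #|~: A| = #|~: V| by have := cardsC A; have := cardsC V; lia.
pose f i := if i \in A then g A V i else g (~: A) (~: V) i.
have fV i : (f i \in V) = (i \in A).
  rewrite /f; case: ifP => iA; first by rewrite gU.
  by apply/negbTE; rewrite -finset.in_setC gU// inE iA.
have finj : injective f.
  move=> i j E; have := fV i; rewrite E fV => ij.
  apply: val_inj; move: E; rewrite /f ij; case: ifP => iA E;
    case: (ltngtP i j) => // H; exfalso.
  - by have := glt _ _ AV i j iA ltac:(by rewrite ij) H; rewrite E ltnn.
  - by have := glt _ _ AV j i ltac:(by rewrite ij) iA H; rewrite E ltnn.
  - by have := glt _ _ AVC i j ltac:(by rewrite inE iA) ltac:(by rewrite inE ij iA) H;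
      rewrite E ltnn.
  - by have := glt _ _ AVC j i ltac:(by rewrite inE ij iA) ltac:(by rewrite inE iA) H;
      rewrite E ltnn.
exists (perm finj); split => [i|i j iA jA|i j iA jA]; rewrite !permE//.
  by rewrite /f iA jA; exact: glt.
by move: (iA) (jA); rewrite /f !inE => /negbTE -> /negbTE ->; exact: glt.
Qed.

Lemma card_ltS n (A : {set 'I_n}) (i : 'I_n) :
  #|[set j in A | (j < i.+1)%N]| = (#|[set j in A | (j < i)%N]| + (i \in A))%N.
Proof.
rewrite (cardsD1 i) inE ltnSn andbT addnC; congr (_ + _)%N.
apply: eq_card => j; rewrite !inE ltnS ltn_neqAle andbCA; congr (_ && (_ && _)).
Qed.

Section Decode.
Variables (n : nat) (t : n.-tuple letter).
Let A := [set i | (tnth t i).1].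
Let V := [set i | (tnth t i).2].
Hypotheses (t_dyck : dyck t) (t_height : height t = 0).

(** The whole word has height 0, so a suffix compensates the removed prefix. *)
Lemma height_drop i : (i <= n)%N ->
  (height (drop i t) + Posz #|[set j in V | (j < i)%N]| = Posz #|[set j in A | (j < i)%N]|)%R.
Proof.
elim: i => [|i IH] i_n.
  have E0 (B : {set 'I_n}) : [set j in B | (j < 0)%N] = finset.set0.
    by apply/setP => j; rewrite !inE andbF.
  by rewrite drop0 t_height !E0 cards0.
have := IH (ltnW i_n).
rewrite (drop_nth (false, false)) ?size_tuple//=.
have -> : nth (false, false) t i = tnth t (Ordinal i_n) by rewrite (tnth_nth (false, false)).
have -> : #|[set j in A | (j < i.+1)%N]| = _ := card_ltS A (Ordinal i_n).
have -> : #|[set j in V | (j < i.+1)%N]| = _ := card_ltS V (Ordinal i_n).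
rewrite !inE /= /bz !PoszD.
move: (height _) #|[set j in A | _]| #|[set j in V | _]| (tnth _ _) => h x y [a b]; lia.
Qed.

Lemma dyck_drop (i : 'I_n) :
  (0 <= height (drop i t) /\ ((tnth t i).1 || (0 < height (drop i t))))%R.
Proof.
have D : dyck (drop i t).
  move: (val t) t_dyck (nat_of_ord i) => s; elim: s => [|a s IH] //= /and3P[ds h1 h2] [|j] /=.
    by rewrite ds h1.
  exact: IH.
move: D; rewrite (drop_nth (false, false)) ?size_tuple// -tnth_nth.
by move=> /and3P[].
Qed.

Lemma exists_exc_word : exists2 s : 'S_n, s \in Av (decr 3) n & exc_word s = t.
Proof.
have AV : #|A| = #|V|.
  have := height_drop (leqnn n); rewrite drop_oversize ?size_tuple//= add0r.
  have E (B : {set 'I_n}) : [set j in B | (j < n)%N] = B.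
    by apply/setP => j; rewrite inE ltn_ord andbT.
  by rewrite !E => -[].
have [s [sV sA sC]] := exists_perm_of_sets AV.
have wexcE i : wexc s i = (i \in A).
  have [h0 h1] := dyck_drop i; have hd := height_drop (ltnW (ltn_ord i)).
  apply/idP/idP => [wi|iA]; apply: contraT.
    move=> iA; rewrite inE in iA; rewrite (negbTE iA) /= in h1.
    have iC : i \in ~: A by rewrite !inE.
    (* If [i] outside [A] were a weak excedance, each value of [~: V] below [i] would come from a
       position of [~: A] left of [i]; passing to complements, the height at [i] would not be
       positive. *)
    have : (#|[set y in ~: V | (y < i)%N]| <= #|[set j in ~: A | (j < i)%N]|)%N.
      rewrite -(card_imset _ (@perm_inj _ (s^-1)%g)); apply: subset_leq_card.
      apply/fintype.subsetP => j /imsetP[y]; rewrite !inE => /andP[yV yi] ->.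
      have jC : (s^-1)%g y \in ~: A by rewrite inE -sV permKV inE.
      have := jC; rewrite !inE => -> /=; rewrite ltnNge leq_eqVlt; apply/norP; split.
        by apply/eqP => /val_inj E; move: wi; rewrite /wexc {2}E permKV leqNgt yi.
      apply/negP => /(sC _ _ iC jC); rewrite permKV => siy.
      by move: wi; rewrite /wexc leqNgt (ltn_trans siy yi).
    have split (B : {set 'I_n}) :
        (#|[set j in B | (j < i)%N]| + #|[set j in ~: B | (j < i)%N]| = i)%N.
      rewrite -[RHS](card_ord_lt (ltnW (ltn_ord i))) -(cardsID B [set j : 'I_n | (j < i)%N]).
      by congr (_ + _)%N; apply: eq_card => j; rewrite !inE andbC.
    have := split A; have := split V; move: hd h1; move: (height _) #|[set j in V | _]|
      #|[set j in ~: V | _]| #|[set j in A | _]| #|[set j in ~: A | _]| => h x x' y y'; lia.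
  rewrite /wexc -ltnNge => si.
  (* If [s i < i] with [i] in [A], the elements of [A] up to [i] are sent into [V] below [i], and
     the height is negative. *)
  have : (#|[set j in A | (j < i.+1)%N]| <= #|[set y in V | (y < i)%N]|)%N.
    rewrite -(card_imset _ (@perm_inj _ s)); apply: subset_leq_card.
    apply/fintype.subsetP => y /imsetP[j]; rewrite [j \in _]inE => /andP[jA ji] ->.
    rewrite inE sV jA /=; move: ji; rewrite ltnS leq_eqVlt => /orP[/eqP/val_inj ->//|ji].
    exact: ltn_trans (sA _ _ jA iA ji) si.
  rewrite card_ltS iA; move: hd h0.
  by move: (height _) #|[set j in V | _]| #|[set j in A | _]| => h x y; lia.
exists s.
  (* Two of any three positions lie both in [A] or both outside it, where [s] increases. *)
  apply/Av321P => i j l /andP[ij jl]; apply/negP => /andP[slj sji].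
  have il := ltn_trans ij jl; have sli := ltn_trans slj sji.
  have C x : (x \in ~: A) = (x \notin A) by rewrite inE.
  case: (boolP (j \in A)) => jA.
    case: (boolP (i \in A)) => iA; first by have := sA _ _ iA jA ij; rewrite ltnNge ltnW.
    case: (boolP (l \in A)) => lA; first by have := sA _ _ jA lA jl; rewrite ltnNge ltnW.
    by have := sC i l; rewrite !C => /(_ iA lA il); rewrite ltnNge ltnW.
  case: (boolP (i \in A)) => iA; last first.
    by have := sC i j; rewrite !C => /(_ iA jA ij); rewrite ltnNge ltnW.
  case: (boolP (l \in A)) => lA; first by have := sA _ _ iA lA il; rewrite ltnNge ltnW.
  by have := sC j l; rewrite !C => /(_ jA lA jl); rewrite ltnNge ltnW.
apply: eq_from_tnth => i; rewrite tnth_mktuple wexcE.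
have -> : wexc_val s i = (i \in V).
  by rewrite -[i in LHS](permKV s) wexc_valE wexcE -sV permKV.
by rewrite !inE -surjective_pairing.
Qed.

End Decode.

Lemma card_Av321_ge n : (4 ^ n <= (n.+1 * (2 * n).+1) * #|Av (decr 3) n|)%N.
Proof.
apply: leq_trans (ballot_ge n) _; rewrite leq_mul2l orbC.
suff -> : (ballot n 0 <= #|Av (decr 3) n|)%N by [].
apply: leq_trans (leq_imset_card (@exc_word n) _).
have -> : ballot n 0 = #|[set t : n.-tuple letter | dyck t && (height t == 0)%R]|.
  by rewrite -sum1dep_card [RHS]big_mkcond.
apply: subset_leq_card; apply/fintype.subsetP => t; rewrite inE => /andP[dt /eqP ht].
by have [s sav <-] := exists_exc_word dt ht; exact: imset_f.
Qed.

(** * Words inducing a given pattern *)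

Definition descent n (s : 'S_n) (m : nat) : bool :=
  (m.+1 < n)%N && (value s m.+1 < value s m)%N.

Lemma occ_at_decr2 n (s : 'S_n) m : occ_at (decr 2) s m = descent s m.
Proof.
rewrite /occ_at /descent addn2; congr (_ && _).
apply/forallP/idP => [/(_ ord_max)/forallP/(_ ord0)/eqP|H a].
  by rewrite !permE /= addn0 addn1.
apply/forallP => b; case: a b => [[|[|a]] ha] [[|[|b]] hb] //;
  rewrite !permE /= ?addn0 ?addn1 ?ltnn ?H//.
by rewrite [(value s m < _)%N]ltnNge (ltnW H).
Qed.

Lemma cocc_decr2 n (s : 'S_n) : cocc (decr 2) s = #|[set m : 'I_n | descent s m]|.
Proof.
rewrite cocc_sum// -sum1dep_card [RHS]big_mkcond.
by apply: eq_bigr => m _; rewrite occ_at_decr2.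
Qed.

Lemma value_incr n (s : 'S_n) (i j : nat) : (i < j < n)%N ->
  (forall m, (i <= m < j)%N -> ~~ descent s m) -> (value s i < value s j)%N.
Proof.
elim: j => // j IH /andP[ij jn] H.
have step : (value s j < value s j.+1)%N.
  have := H j ltac:(by rewrite ltnSn andbT -ltnS).
  have va : value s j = s (Ordinal (ltnW jn)) := valueE s (Ordinal (ltnW jn)).
  have vb : value s j.+1 = s (Ordinal jn) := valueE s (Ordinal jn).
  rewrite /descent jn va vb /= -leqNgt leq_eqVlt.
  by case/orP => // /eqP/val_inj/perm_inj/(congr1 val) /=; lia.
move: ij; rewrite ltnS leq_eqVlt => /orP[/eqP ->//|ij].
apply: ltn_trans step; apply: IH => [|m /andP[im mj]]; first by rewrite ij ltnW.
by apply: H; rewrite im ltnW.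
Qed.

(** Cutting the values at [t] gives the only candidates for words inducing [pi]. *)
Definition threshold k (pi : 'S_k) (t : nat) : k.-tuple bool :=
  [tuple (t <= pi a)%N | a < k].

Lemma nth_threshold k (pi : 'S_k) t (a : 'I_k) :
  nth false (threshold pi t) a = (t <= pi a)%N.
Proof. by rewrite -tnth_nth tnth_mktuple. Qed.

Lemma threshold_inj k (pi : 'S_k) :
  injective (fun t : 'I_k.+1 => threshold pi t).
Proof.
suff lt (t u : 'I_k.+1) : (t < u)%N -> threshold pi t <> threshold pi u.
  by move=> t u E; apply: val_inj; case: (ltngtP t u) => // /lt; rewrite E.
move=> tu E; have tk : (t < k)%N by have := ltn_ord u; lia.
have := nth_threshold pi u ((pi^-1)%g (Ordinal tk)); rewrite -E nth_threshold permKV /=.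
by rewrite leqnn leqNgt tu.
Qed.

(** The values at the [false] letters form an initial segment, whose size is the threshold. *)
Lemma induces_threshold k (pi : 'S_k) (w : k.-tuple bool) :
  induces pi w -> exists t : 'I_k.+1, w = threshold pi t.
Proof.
move=> /forallP H; pose D := [set v | ~~ tnth w ((pi^-1)%g v)].
have Dlt (u v : 'I_k) : (u < v)%N -> v \in D -> u \in D.
  move=> uv; rewrite !inE; have /forallP/(_ ((pi^-1)%g v))/eqP := H ((pi^-1)%g u).
  rewrite !permKV uv /word_lt -!tnth_nth => /esym/orP[/andP[//]|/andP[/eqP -> //]].
have Dk : (#|D| < k.+1)%N by rewrite ltnS; have := max_card D; rewrite card_ord.
exists (Ordinal Dk); apply: eq_from_tnth => a; rewrite tnth_mktuple /=.
have aD : (pi a \in D) = ~~ tnth w a by rewrite inE permK.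
case: (boolP (tnth w a)) aD => wa aD.
  apply/esym; rewrite -[leqRHS](card_ord_lt (ltnW (ltn_ord (pi a)))).
  apply: subset_leq_card; apply/fintype.subsetP => v vD; rewrite inE ltnNge leq_eqVlt.
  apply/norP; split; first by apply/eqP => /val_inj E; rewrite E vD in aD.
  by apply/negP => /Dlt/(_ vD); rewrite aD.
apply/esym/negbTE; rewrite -ltnNge -[X in (X < _)%N]/(nat_of_ord (pi a)).
rewrite -[leqLHS](card_ord_lt (ltn_ord (pi a))); apply: subset_leq_card.
apply/fintype.subsetP => v; rewrite inE ltnS leq_eqVlt => /orP[/eqP/val_inj ->|/Dlt]; last exact.
by rewrite aD.
Qed.

(** The cut induces [pi] when the inverse increases on the values below [t] and on those from [t]
    on: its only possible descent is from [t - 1] to [t]. *)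
Lemma induces_thresholdE k (pi : 'S_k) (t : nat) :
  induces pi (threshold pi t) = [forall m : 'I_k, descent (pi^-1)%g m ==> (m.+1 == t)].
Proof.
apply/forallP/forallP => [H m|H a].
  apply/implyP => /andP[mk]; apply: contraTT => mt.
  have /forallP/(_ ((pi^-1)%g (Ordinal mk)))/eqP := H ((pi^-1)%g m).
  rewrite /word_lt !nth_threshold !permKV /= ltnSn.
  rewrite (_ : (t <= m.+1)%N = (t <= m)%N) ?eqxx ?andNb; last by lia.
  rewrite -!(valueE (pi^-1)%g) /= -leqNgt => /esym/= H1; exact: ltnW.
apply/forallP => b; rewrite /word_lt !nth_threshold.
have mono (u v : 'I_k) : (u < v)%N -> (t <= u)%N = (t <= v)%N ->
    ((pi^-1)%g u < (pi^-1)%g v)%N.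
  move=> uv tuv; rewrite -!(valueE (pi^-1)%g); apply: value_incr.
    by rewrite uv ltn_ord.
  move=> m /andP[um mv]; apply/negP => dm.
  have mk : (m < k)%N by apply: ltn_trans mv _.
  have := H (Ordinal mk); rewrite /= dm /= => /eqP; lia.
case: (eqVneq (t <= pi a)%N (t <= pi b)%N) => E; last first.
  by apply/eqP; move: E; case: (leqP t (pi a)); case: (leqP t (pi b)) => //=; lia.
rewrite E andNb /=; apply/eqP.
case: (ltngtP (pi a) (pi b)) => ab.
- by have := mono _ _ ab E; rewrite !permK => ->.
- by have := mono _ _ ab (esym E); rewrite !permK ltnNge => H1; apply/esym/negbTE;
    rewrite -leqNgt ltnW// ltnNge.
- by rewrite (perm_inj (val_inj ab)) ltnn.
Qed.

Lemma descent_perm1 k (pi : 'S_k) : (pi == 1%g) = (#|[set m : 'I_k | descent (pi^-1)%g m]| == 0%N).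
Proof.
apply/eqP/eqP => [->|/cards0_eq D0].
  apply/eqP; rewrite cards_eq0; apply/eqP/setP => m; rewrite !inE invg1.
  apply/negP => /andP[mk]; rewrite (valueE 1%g (Ordinal mk)) (valueE 1%g m) !perm1 /=.
  by rewrite ltnNge leqnSn.
suff : (pi^-1 = 1)%g by move/(congr1 invg); rewrite invgK invg1.
have incr (a b : 'I_k) : (a < b)%N -> ((pi^-1)%g a < (pi^-1)%g b)%N.
  move=> ab; rewrite -!(valueE (pi^-1)%g); apply: value_incr.
    by rewrite ab ltn_ord.
  move=> m /andP[_ mb]; have mk : (m < k)%N by apply: ltn_trans mb _.
  by have /setP/(_ (Ordinal mk)) := D0; rewrite !inE => ->.
apply: perm_order_inj => a b; rewrite !perm1.
case: (ltngtP a b) => ab; first exact: incr.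
  by apply/negbTE; rewrite -leqNgt ltnW// incr.
by rewrite (val_inj ab) ltnn.
Qed.

(** Without descent of the inverse all [k + 1] thresholds work; one descent forces the threshold,
    and two exclude each other. *)
Lemma card_induces k (pi : 'S_k) :
  #|[set w : k.-tuple bool | induces pi w]| =
  if pi == 1%g then k.+1 else (cocc (decr 2) (pi^-1)%g == 1%N : nat).
Proof.
have -> : #|[set w : k.-tuple bool | induces pi w]| =
    #|[set t : 'I_k.+1 | [forall m : 'I_k, descent (pi^-1)%g m ==> (m.+1 == t)]]|.
  rewrite -(card_imset _ (@threshold_inj k pi)); apply: eq_card => w.
  rewrite inE; apply/idP/imsetP => [iw|[t]].
    have [t wt] := induces_threshold iw; exists t => //.
    by rewrite inE -induces_thresholdE -wt.
  by rewrite inE -induces_thresholdE => it ->.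
rewrite descent_perm1 cocc_decr2; set D := [set m : 'I_k | descent _ m].
have DE m : descent (pi^-1)%g (nat_of_ord m) = (m \in D) by rewrite inE.
case: (eqVneq #|D| 0%N) => [/cards0_eq D0|/negbTE Dn0].
  rewrite -[RHS]card_ord -cardsT; apply: eq_card => t; rewrite !inE.
  by apply/forallP => m; rewrite DE D0 inE.
case: (boolP (#|D| == 1%N)) => [/cards1P[m Dm]|D1].
  have mk : (m.+1 < k.+1)%N by rewrite ltnS.
  rewrite -[RHS](cards1 (Ordinal mk)); apply: eq_card => t; rewrite !inE -val_eqE /=.
  apply/forallP/eqP => [/(_ m)|->] /=.
    by rewrite DE Dm set11 /= => /eqP.
  by move=> m'; rewrite DE Dm inE; apply/implyP => /eqP ->.
apply/eqP; rewrite cards_eq0; apply/eqP/setP => t; rewrite !inE.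
apply/negP => /forallP H.
have : (#|D| <= 1)%N; last by move: Dn0 D1; case: #|D| => [|[|]].
rewrite leqNgt; apply/negP => /card_gt1P[x [y [xD yD xy]]].
have := H x; have := H y; rewrite !DE xD yD /= => /eqP Ey /eqP Ex.
by case/negP: xy; rewrite -val_eqE /= -eqSS Ex Ey.
Qed.

(** * Concentration *)

Local Open Scope ring_scope.

Definition short_words (k : nat) : seq (bool * seq bool) :=
  [seq (b, w) | b <- [:: true; false],
                w <- flatten [seq map val (enum {: j.-tuple bool}) | j <- iota 0 k]].

Lemma mem_short_words k b (w : seq bool) : (size w < k)%N -> (b, w) \in short_words k.
Proof.
move=> wk; apply: allpairs_f; first by case: b.
apply/flattenP; exists (map val (enum {: (size w).-tuple bool})).
  by apply/mapP; exists (size w); rewrite ?mem_iota.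
by apply/mapP; exists (in_tuple w); rewrite ?mem_enum.
Qed.

Definition atypical (k m : nat) (s : seq letter) : bool :=
  (nonneg s && (size s <= m * low k s)%N) ||
  has (fun bw => (size s)%:Z < m%:Z * drift bw.1 bw.2 s) (short_words k).

Lemma rare_atypical (R : realType) k m : (1 < m)%N -> rare R (atypical k m).
Proof.
move=> m1; pose B1 s := nonneg s && (size s <= m * low k s)%N.
pose B2 s bw := (size s)%:Z < m%:Z * drift bw.1 bw.2 s.
apply: (@rareU R B1 (fun s => has (B2 s) (short_words k))); first exact: rare_low.
by apply: (@rare_has R _ _ (fun bw s => B2 s bw)) => bw; exact: rare_drift.
Qed.

Lemma cocc_limitE (R : realType) k (pi : 'S_k) :
  cocc_limit R pi = #|[set w : k.-tuple bool | induces pi w]|%:R / 2 ^+ k.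
Proof.
rewrite card_induces /cocc_limit addn1; case: ifP => // _.
by case: ifP => // _; rewrite mul0r.
Qed.

(** In the constant, [k] accounts for low windows, [2 ^ k] for the deviations of at most [2 ^ k]
    factor counts, and 1 for replacing [n + 1] by [n]. *)
Lemma cocc_freq_dev (R : realType) k n m (pi : 'S_k) (s : 'S_n) :
  (0 < k)%N -> (0 < n)%N -> (0 < m)%N -> s \in Av (decr 3) n ->
  ~~ atypical k m (exc_word s) ->
  `|cocc_freq R pi s - cocc_limit R pi|
    <= (k + 2 ^ k + 1)%:R * (m%:R^-1 + n%:R^-1).
Proof.
move=> k0 n0 m0 sav; rewrite /atypical negb_or nonneg_exc_word andTb -ltnNge size_tuple.
move=> /andP[lowlt /hasPn H].
have cntd (w : k.-tuple bool) :
    (m%:Z * `|(2 ^ k * cnt w (exc_word s))%:Z - n.+1%:Z| <= (2 ^ k)%:Z * (n%:Z + m%:Z)).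
  have dr b v : (size v < k)%N -> m%:Z * drift b v (exc_word s) <= (size (exc_word s))%:Z.
    by move=> vk; have := H _ (mem_short_words b vk); rewrite size_tuple -leNgt.
  have := cnt_deviation dr (w := w); rewrite !size_tuple; exact.
have cd := cocc_dev pi sav k0.
rewrite cocc_limitE; set M := #|_|.
have Mk : (M <= 2 ^ k)%N by rewrite -card_bool -card_tuple max_card.
have sumd : m%:Z * `|(2 ^ k * \sum_(w : k.-tuple bool | induces pi w) cnt w (exc_word s))%:Z
      - (M * n.+1)%:Z| <= (M * (2 ^ k * (n + m)))%:Z.
  have -> : (2 ^ k * \sum_(w : k.-tuple bool | induces pi w) cnt w (exc_word s))%:Z
      - (M * n.+1)%:Z =
      \sum_(w : k.-tuple bool | induces pi w) ((2 ^ k * cnt w (exc_word s))%:Z - n.+1%:Z).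
    rewrite sumrB sumr_const -/(2 ^ k)%N; congr (_ - _).
      by rewrite big_distrr /= (big_morph Posz PoszD (erefl _)).
    by rewrite /M cardsE -mulr_natl natz PoszM.
  apply: le_trans (ler_wpM2l _ (ler_norm_sum _ _ _)) _ => //.
  rewrite mulr_sumr; apply: le_trans (ler_sum _ (fun w _ => cntd w)) _.
  by rewrite sumr_const /M cardsE -mulr_natl natz !PoszM PoszD.
move: (\sum_(w | _) _)%N sumd cd => y sumd cd.
rewrite /cocc_freq; move: (cocc pi s) cd => x cd.
pose q := (2 ^ k)%N; have q0 : (0 < q)%N by rewrite expn_gt0.
have main : m%:Z * `|x%:Z * q%:Z - M%:Z * n%:Z| <= (q * (k + q + 1) * (n + m))%:Z.
  have E : x%:Z * q%:Z - M%:Z * n%:Z =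
    q%:Z * (x%:Z - y%:Z) + ((q * y)%:Z - (M * n.+1)%:Z) + M%:Z by lia.
  have T : `|x%:Z * q%:Z - M%:Z * n%:Z| <=
      q%:Z * `|x%:Z - y%:Z| + `|(q * y)%:Z - (M * n.+1)%:Z| + M%:Z.
    rewrite E; apply: le_trans (ler_normD _ _) _.
    rewrite [`|M%:Z|]ger0_norm// lerD2r.
    by apply: le_trans (ler_normD _ _) _; rewrite normrM (ger0_norm (_ : 0 <= q%:Z)).
  have mZ : 0 <= m%:Z by [].
  apply: le_trans (ler_wpM2l mZ T) _; rewrite !mulrDr.
  have H1 : m%:Z * (q%:Z * `|x%:Z - y%:Z|) <= (q * (k * (n + m)))%:Z.
    rewrite mulrCA PoszM ler_wpM2l//; apply: le_trans (ler_wpM2l mZ cd) _; nia.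
  have H2 : (M * (q * (n + m)) <= q * (q * (n + m)))%N by rewrite leq_mul2r Mk orbT.
  have H3 : (m * M <= q * (n + m))%N by rewrite mulnC leq_mul// leq_addl.
  have := lerD (lerD H1 sumd) (_ : m%:Z * M%:Z <= (q * (n + m))%:Z); rewrite -/q.
  move=> /(_ ltac:(by rewrite -PoszM)) /le_trans; apply; lia.
have mR : 0 < m%:R :> R by rewrite ltr0n.
have nR : 0 < n%:R :> R by rewrite ltr0n.
have qR : 0 < q%:R :> R by rewrite ltr0n.
have -> : x%:R / n%:R - M%:R / 2 ^+ k = (x%:R * q%:R - M%:R * n%:R) / (n%:R * q%:R) :> R.
  by rewrite /q natrX; field; rewrite -natrX -/q !gt_eqF.
rewrite normrM (ger0_norm (_ : 0 <= (n%:R * q%:R)^-1)); last first.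
  by rewrite invr_ge0 mulr_ge0// ltW.
rewrite ler_pdivrMr ?mulr_gt0//.
have mainR : m%:R * `|x%:R * q%:R - M%:R * n%:R| <= q%:R * (k + q + 1)%:R * (n%:R + m%:R) :> R.
  move: main; rewrite -(ler_int R) !rmorphM /= intr_norm rmorphB !rmorphM /=.
  by rewrite -!natrD -!natrM.
rewrite -(ler_pM2l mR); apply: le_trans mainR _.
rewrite le_eqVlt; apply/orP; left; apply/eqP.
by field; rewrite !gt_eqF.
Qed.

(** * Transfer to random permutations *)

Lemma probability_uniform_on (R : realType) (d : measure_display)
    (Omega : measurableType d) (P : probability Omega R)
    (S : finType) (A : {set S}) (X : Omega -> S) (B : pred S) :
  uniform_on P A X ->
  P [set w | B (X w)]%classic = (#|[set s in A | B s]|%:R / #|A|%:R)%:E.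
Proof.
move=> HX.
(* Measurability is given for fibres of single points, so events are built as finite disjoint unions
   of fibres. *)
have mX (r : seq S) : measurable [set w | X w \in r]%classic.
  elim: r => [|s r IH].
    by rewrite (_ : [set w | _]%classic = set0)%classic//; apply/seteqP; split.
  rewrite (_ : [set w | _]%classic =
      (X @^-1` [set s] `|` [set w | X w \in r])%classic).
    by apply: measurableU => //; case: (HX s).
  apply/seteqP; split => w /=; rewrite inE.
    by case/orP => [/eqP|]; [left|right].
  by case=> ->; rewrite ?eqxx ?orbT.
have PX (r : seq S) : uniq r ->
    P [set w | X w \in r]%classic =
    (\sum_(s <- r) (if s \in A then #|A|%:R^-1 else 0))%:E.
  elim: r => [|s r IH] /=.
    move=> _; rewrite big_nil (_ : [set w | _]%classic = set0)%classic ?measure0//.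
    by apply/seteqP; split.
  move=> /andP[sr ur]; rewrite big_cons EFinD -IH// -(HX s).2.
  rewrite -measureU//; last 2 first.
  - by case: (HX s).
  - by apply/seteqP; split => // w /= [->]; rewrite (negbTE sr).
  congr (P _); apply/seteqP; split => w /=; rewrite inE.
    by case/orP => [/eqP|]; [left|right].
  by case=> ->; rewrite ?eqxx ?orbT.
rewrite (_ : [set w | _]%classic = [set w | X w \in enum B]%classic); last first.
  by apply/seteqP; split => w /=; rewrite mem_enum.
rewrite PX ?enum_uniq// big_enum_cond /= -big_mkcondr /=; congr (_%:E).
rewrite sumr_const mulr_natl; congr (_ *+ _); apply: eq_card => s.
by rewrite [RHS]inE andbC -[LHS]topredE /= andbT.
Qed.

(** [exc_word] injects the deviating permutations into the atypical words. Their number, at most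
    [C * 4 ^ n / (n + 1) ^ 3], is divided by at least [4 ^ n / ((n + 1) * (2 * n + 1))]. *)
Lemma deviation_le (R : realType) k m (pi : 'S_k) (eps : R) :
  (0 < k)%N -> (1 < m)%N ->
  exists C : R, forall n, (0 < n)%N ->
    (k + 2 ^ k + 1)%:R * (m%:R^-1 + n%:R^-1) <= eps ->
    #|[set s in Av (decr 3) n | eps < `|cocc_freq R pi s - cocc_limit R pi| ]|%:R
      / #|Av (decr 3) n|%:R <= C * n.+1%:R^-1.
Proof.
move=> k0 m1; have [C HC] := rare_atypical R k m1; exists (2 * C) => n n0 dev.
set D := finset _; set a := #|Av _ _|.
have Da : (#|D| <= #|[set t : n.-tuple letter | atypical k m t]|)%N.
  rewrite -(@card_in_imset _ _ (@exc_word n) D); last first.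
    by move=> s t /setIdP[sA _] /setIdP[tA _]; exact: exc_word_inj.
  apply: subset_leq_card; apply/fintype.subsetP => _ /imsetP[s /setIdP[sA sd] ->].
  rewrite inE; apply: contraLR sd => ty; rewrite -leNgt; apply: le_trans dev.
  exact: cocc_freq_dev (ltnW m1) sA ty.
have [a0|a0] := eqVneq a 0%N.
  by have := card_Av321_ge n; rewrite -/a a0 muln0 leqn0 expn_eq0.
have aR : 0 < a%:R :> R by rewrite ltr0n lt0n.
have n1R : 0 < n.+1%:R :> R by rewrite ltr0n.
rewrite ler_pdivrMr// -(ler_pM2l (_ : 0 < (n.+1 ^ 3)%:R :> R)); last first.
  by rewrite ltr0n expn_gt0.
apply: (@le_trans _ _ (C * 4 ^+ n)).
  by apply: le_trans (HC n); rewrite ler_wpM2l// ler_nat.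
have C0 : 0 <= C.
  have := HC 0%N; rewrite expr0 mulr1; apply: le_trans.
  by rewrite mulr_ge0.
rewrite (_ : (n.+1 ^ 3)%:R * _ = C * (2 * n.+1%:R ^+ 2 * a%:R)); last first.
  by rewrite natrX; field; rewrite gt_eqF.
rewrite ler_wpM2l// -!natrX -!natrM ler_nat.
apply: leq_trans (card_Av321_ge n) _; rewrite -/a leq_mul2r; apply/orP; right; lia.
Qed.

Theorem theorem1p9 (R : realType) (d : nat -> measure_display)
    (Omega : forall n : nat, measurableType (d n))
    (P : forall n : nat, probability (Omega n) R)
    (sigma : forall n : nat, Omega n -> 'S_n)
    (sigma_uniform : forall n : nat, (0 < n)%N ->
       uniform_on (P n) (Av (decr 3) n) (sigma n))
    (k : nat) (k_gt0 : (0 < k)%N) (pi : 'S_k) (pi_av : pi \in Av (decr 3) k) :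
  cvg_in_probability P (fun n w => cocc_freq R pi (sigma n w))
    (cocc_limit R pi).
Proof.
move=> eps eps0; pose D : R := (k + 2 ^ k + 1)%:R.
have D0 : 0 < D by rewrite ltr0n addn1.
(* The same bound serves for the parameter [m] and for the length [n]: each of the two error terms
   gets half of [eps]. *)
have [m0 m0E] : exists m0 : nat, 2 * D / eps < m0%:R.
  by exists (Num.bound (2 * D / eps)); apply: archi_boundP; rewrite divr_ge0 ?mulr_ge0 // ltW.
have small m : (m0 <= m)%N -> D * m%:R^-1 <= eps / 2.
  move=> le_m; have lt_m : 2 * D / eps < m%:R by apply: lt_le_trans m0E _; rewrite ler_nat.
  have m_gt0 : 0 < m%:R :> R by apply: le_lt_trans lt_m; rewrite divr_ge0 ?mulr_ge0 // ltW.
  rewrite ler_pdivrMr//; move: lt_m; rewrite ltr_pdivrMr//; nra.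
(* Taking [m0.+2] ensures that the parameter exceeds 1. *)
have [C HC] := @deviation_le R k m0.+2 pi eps k_gt0 isT.
apply: (@squeeze_cvge _ _ _ _ (cst 0%E) _ (fun n => (C * n.+1%:R^-1)%:E)).
- near=> n; apply/andP; split; first exact: measure_ge0.
  have n0 : (0 < n)%N by near: n; exact: nbhs_infty_gt.
  have nm : (m0 <= n)%N by near: n; exact: nbhs_infty_ge.
  rewrite (probability_uniform_on (fun s => eps < `|cocc_freq R pi s - cocc_limit R pi|)
    (sigma_uniform n n0)) lee_fin.
  apply: HC => //; rewrite mulrDr -/D.
  rewrite [leRHS]splitr; apply: lerD; last exact: small.
  by apply: small; rewrite !leqW.
- exact: cvg_cst.
- apply: cvg_EFin; first by near=> n.
  rewrite (_ : _ \o _ = fun n => C * harmonic n)//.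
  by rewrite -[X in (_ --> X)%classic](mulr0 C); apply: cvgM; [exact: cvg_cst|exact: cvg_harmonic].
Unshelve. all: by end_near.
Qed.
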